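(* For every $\delta \in (0,1)$, there exists a graph $G$ with $m$ edges such that \[ \mathrm{sp}(G) \leq \frac{m}{(\pi-\delta)\,(\chi_{\mathrm{vec}}(G)-1)}. \]
   Context: All graphs are finite and simple. For a graph $G=(V,E)$ with $m$ edges, $\mathrm{mc}(G)$ (the MaxCut of $G$) denotes the maximum number of edges of a bipartite subgraph of $G$, equivalently $\max_{C\subseteq V} e(C, V\setminus C)$, where $e(C,V\setminus C)$ is the number of edges with one endpoint in $C$ and the other in $V\setminus C$. The surplus of $G$ is $\mathrm{sp}(G)=\mathrm{mc}(G)-m/2$. The vector chromatic number $\chi_{\mathrm{vec}}(G)$ is the minimum real number $\kappa\ge 2$ for which there exists an assignment of unit vectors $\mathbf{x}_i$ (in some Euclidean space) to the vertices $i\in V$ such that $\langle \mathbf{x}_i,\mathbf{x}_j\rangle \le -(\kappa-1)^{-1}$ for every edge $ij\in E$. *)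

(* Defs.v *)
From HB Require Import structures.
From mathcomp Require Import all_boot all_order all_algebra.
From mathcomp Require Import all_classical all_reals all_analysis.

Set Implicit Arguments.
Unset Strict Implicit.
Unset Printing Implicit Defensive.

Import Order.TTheory GRing.Theory Num.Theory.

Local Open Scope ring_scope.

Record sgraph := SGraph {
  vertex :> finType;
  adj : rel vertex;
  adj_sym : symmetric adj;
  adj_irrefl : irreflexive adj }.

Definition edges (G : sgraph) : {set {set G}} :=
  [set [set x; y]%SET | x in [set: G]%SET, y in [set: G]%SET & adj x y]%SET.

Definition cut_edges (G : sgraph) (C : {set G}) : {set {set G}} :=
  [set [set x; y]%SET | x in C, y in (~: C)%SET & adj x y]%SET.

Definition maxcut (G : sgraph) : nat :=
  (\max_(C : {set G}) #|cut_edges C|)%N.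

Definition surplus (R : realType) (G : sgraph) : R :=
  (maxcut G)%:R - #|edges G|%:R / 2.

Definition dotp (R : realType) (d : nat) (u v : 'rV[R]_d) : R :=
  \sum_(k < d) u ord0 k * v ord0 k.

Definition vector_colorable (R : realType) (G : sgraph) (kappa : R) : Prop :=
  exists (d : nat) (x : G -> 'rV[R]_d),
    (forall i : G, dotp (x i) (x i) = 1) /\
    (forall i j : G, adj i j -> dotp (x i) (x j) <= - (kappa - 1)^-1).

(* Stated as a relation, so that the minimum is attained by definition. *)
Definition is_vector_chromatic_number (R : realType) (G : sgraph)
    (kappa : R) : Prop :=
  [/\ 2 <= kappa, vector_colorable G kappa &
      forall kappa' : R, 2 <= kappa' -> vector_colorable G kappa' ->
        kappa <= kappa'].

(* Main.v *)
Require Import Defs.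
From HB Require Import structures.
From mathcomp Require Import all_boot all_order all_algebra.
From mathcomp Require Import all_classical all_reals all_analysis.
From mathcomp Require Import perm measurable_realfun ring lra.

(**
Take pairs (x, y) of uniform points of a cube whose bits have correlation -r,
group the bits into D blocks of size k, and let the vertices be the vectors z
in R^D of block sums.  For F with values in [-1, 1] depending on z only,
   E F(x) F(y) = sum_S (-r)^|S| F^(S)^2 >= - r W - r^3,
where W is the degree-one Fourier weight of F.  The degree-one coefficients are
constant on blocks, hence small, so Stein's method shows that the linear part X
of F is nearly Gaussian: W = E F X <= E |X| <= sqrt(2 W / pi) + o(1), whence
W <= 2/pi + o(1) as k grows.  For fixed k and large D, <z, z'> is close to
- r |z| |z'| with high probability (Chebyshev); discarding the other pairs gives
a weighted graph with a vector colouring of inner products at most -c, c < r, in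
which every cut has surplus at most about (r/pi + r^3/2) times the weight.  A
pseudo-random blow-up over a finite field replaces the weights by simple edges,
and a disjoint K_t with c = 1/(t-1) makes the vector chromatic number exactly t.
Since r/c is as close to 1, and r as close to 0, as desired, the constant pi is
approached.
*)

Set Implicit Arguments.
Unset Strict Implicit.
Unset Printing Implicit Defensive.
Import Order.TTheory GRing.Theory Num.Theory.
Import numFieldNormedType.Exports.

Local Open Scope ring_scope.

(** * Gaussian tails and the scaled complementary error function *)

Section GaussTail.
Local Open Scope classical_set_scope.
Variable R : realType.
Implicit Types (x y u v t : R) (f df : R -> R).

Lemma ge0_is_derive_le f df u v :
  (forall x, is_derive x 1 f (df x)) ->
  (forall x, u < x < v -> 0 <= df x) -> u <= v -> f u <= f v.
Proof.
move=> fdf df0 uv.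
apply: (@ger0_derive1_ndecr _ f u v) => // [x xuv|].
  by rewrite derive1E derive_val df0// -[_ && _]/(x \in `]u, v[).
by apply: derivable_within_continuous.
Qed.

Lemma ge0_is_derive_le_cvgy f df u (l : R) :
  (forall x, is_derive x 1 f (df x)) ->
  (forall x, u < x -> 0 <= df x) -> f x @[x --> +oo] --> l -> f u <= l.
Proof.
move=> fdf df0 fl; apply: (cvgr_to_ge fl); near=> x.
apply: (ge0_is_derive_le fdf) => [t /andP[+ _]|]; first exact: df0.
by near: x; apply: nbhs_pinfty_ge; rewrite num_real.
Unshelve. all: by end_near. Qed.

Lemma is_derive_gauss_fun x :
  is_derive x 1 (@gauss_fun R) (- 2 * x * gauss_fun x).
Proof.
by rewrite /gauss_fun; apply: is_derive_eq; rewrite /GRing.scale /=; ring.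
Qed.

Local Notation mu := (@lebesgue_measure R).

Definition gauss_tail y : R := \int[mu]_(t in `[y, +oo[) gauss_fun t.

Lemma gauss_tail0 : gauss_tail 0 = Num.sqrt pi / 2.
Proof. by rewrite /gauss_tail /Rintegral integral0y_gauss. Qed.

Lemma gauss_tail_ge0 y : 0 <= gauss_tail y.
Proof. by apply: Rintegral_ge0 => t _; exact: gauss_fun_ge0. Qed.

Lemma integrable_gauss_fun (A : set R) : measurable A ->
  mu.-integrable A (EFin \o (@gauss_fun R)).
Proof.
move=> mA; apply: (integrableS measurableT) => //; exact: integrableT_gauss.
Qed.

Lemma gauss_tailE y :
  gauss_tail y = Num.sqrt pi - \int[mu]_(t in `]-oo, y]) gauss_fun t.
Proof.
have -> : Num.sqrt pi = \int[mu]_(t in `]-oo, +oo[) gauss_fun t.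
  by rewrite set_itvE /Rintegral integralT_gauss.
rewrite Rintegral_itvB ?bnd_simp//; last exact: integrable_gauss_fun.
by rewrite Rintegral_itv_obnd_cbnd//; exact: integrable_gauss_fun.
Qed.

Lemma is_derive_gauss_tail y : is_derive y 1 gauss_tail (- gauss_fun y).
Proof.
pose cdf x := \int[mu]_(t in `]-oo, x]) gauss_fun t.
have cdf_derive : is_derive y 1 cdf (gauss_fun y).
  have [||||dy dyE] := @continuous_FTC1 R gauss_fun -oo%O y (y + 1).
  - by rewrite ltrDl.
  - exact: integrable_gauss_fun.
  - by rewrite ltNyr.
  - exact: continuous_gauss_fun.
  by apply: DeriveDef; [exact: dy|rewrite -derive1E; exact: dyE].
have -> : gauss_tail = fun x => Num.sqrt pi - cdf x.
  by apply/funext => x; exact: gauss_tailE.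
by apply: is_derive_eq; ring.
Qed.

Lemma continuous_gauss_fun_moment :
  continuous (fun t : R => 2 * t * gauss_fun t).
Proof.
move=> t; apply: continuousM; last exact: continuous_gauss_fun.
by apply: continuousM; [exact: cvg_cst|exact: cvg_id].
Qed.

Lemma integral_gauss_fun_moment y : 0 <= y ->
  (\int[mu]_(t in `[y, +oo[) (2 * t * gauss_fun t)%:E = (gauss_fun y)%:E)%E.
Proof.
move=> y0; have primitive t :
    is_derive t 1 (fun x => - gauss_fun x) (2 * t * gauss_fun t).
  have gauss' := is_derive_gauss_fun t.
  by apply: is_derive_eq; rewrite -!mulNr opprK.
rewrite (@ge0_continuous_FTC2y _ _ (fun t => - gauss_fun t) y 0).
- by rewrite sub0e EFinN oppeK.
- by move=> t yt; rewrite !mulr_ge0 ?gauss_fun_ge0// (le_trans y0).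
- by apply: continuous_subspaceT; exact: continuous_gauss_fun_moment.
- by rewrite -oppr0; apply: cvgN; exact: cvg_gauss_fun.
- by move=> t _; case: (primitive t).
- by apply: cvg_at_right_filter; apply: cvgN; exact: continuous_gauss_fun.
- by move=> t _; rewrite derive1E; case: (primitive t).
Qed.

Lemma gauss_mills_ub y : 0 <= y -> 2 * y * gauss_tail y <= gauss_fun y.
Proof.
move=> y0; have y2 : 0 <= 2 * y by rewrite mulr_ge0.
have tail_fin : (\int[mu]_(t in `[y, +oo[) (gauss_fun t)%:E)%E \is a fin_num.
  by apply: integrable_fin_num => //; exact: integrable_gauss_fun.
rewrite -lee_fin -(integral_gauss_fun_moment y0) EFinM fineK//.
rewrite -ge0_integralZl//=; last 2 first.
- by apply/measurable_EFinP/measurable_funTS; exact: measurable_gauss_fun.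
- by move=> t _; rewrite lee_fin gauss_fun_ge0.
apply: ge0_le_integral => //=.
- by move=> t _; rewrite -EFinM lee_fin mulr_ge0 ?gauss_fun_ge0.
- apply: measurable_funeM.
  by apply/measurable_EFinP/measurable_funTS; exact: measurable_gauss_fun.
- apply/measurable_EFinP/measurable_funTS; apply: continuous_measurable_fun.
  exact: continuous_gauss_fun_moment.
- move=> t; rewrite in_itv/= andbT => yt.
  by rewrite -EFinM lee_fin ler_wpM2r ?gauss_fun_ge0// ler_wpM2l.
Qed.

Lemma cvg_gauss_tail : gauss_tail y @[y --> +oo] --> 0.
Proof.
apply: (@squeeze_cvgr _ _ _ _ (cst 0) (@gauss_fun R)); last 2 first.
- exact: cvg_cst.
- exact: cvg_gauss_fun.
near=> y; rewrite gauss_tail_ge0/=.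
have y1 : 1 <= y by near: y; apply: nbhs_pinfty_ge; rewrite num_real.
apply: le_trans (gauss_mills_ub (le_trans ler01 y1)).
by rewrite ler_peMl ?gauss_tail_ge0//; lra.
Unshelve. all: by end_near. Qed.

Let mills_den_gt0 t : 0 < 1 + 2 * t ^+ 2.
Proof. by have := sqr_ge0 t; lra. Qed.

Lemma is_derive_mills_defect t :
  is_derive t 1 (fun x => x / (1 + 2 * x ^+ 2) * gauss_fun x - gauss_tail x)
    (2 * gauss_fun t / (1 + 2 * t ^+ 2) ^+ 2).
Proof.
have den_neq0 : 1 + 2 * t ^+ 2 != 0 by rewrite gt_eqF// mills_den_gt0.
have gauss' := is_derive_gauss_fun t; have tail' := is_derive_gauss_tail t.
have inv_den' : is_derive t 1 (fun x : R => (1 + 2 * x ^+ 2)^-1)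
    (- (1 + 2 * t ^+ 2) ^- 2 *: (4 * t)).
  apply: (@is_deriveV _ (fun x : R => 1 + 2 * x ^+ 2)) => //.
  by apply: is_derive_eq; rewrite /GRing.scale /=; ring.
apply: is_derive_eq; rewrite /GRing.scale /=; field.
by rewrite den_neq0.
Qed.

Lemma gauss_mills_lb y : y * gauss_fun y <= (1 + 2 * y ^+ 2) * gauss_tail y.
Proof.
rewrite -ler_pdivrMl ?mills_den_gt0// mulrA -[_^-1 * y]mulrC -subr_le0.
apply: (ge0_is_derive_le_cvgy is_derive_mills_defect) => [t _|].
  by rewrite divr_ge0 ?sqr_ge0// mulr_ge0 ?gauss_fun_ge0.
rewrite -[X in _ --> X]subr0; apply: cvgB; last exact: cvg_gauss_tail.
apply: (@squeeze_cvgr _ _ _ _ (cst 0) (@gauss_fun R)); last 2 first.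
- exact: cvg_cst.
- exact: cvg_gauss_fun.
near=> t; have t0 : 0 <= t by near: t; apply: nbhs_pinfty_ge; rewrite num_real.
rewrite mulr_ge0 ?gauss_fun_ge0 ?divr_ge0 ?(ltW (mills_den_gt0 t))//=.
rewrite ler_piMl ?gauss_fun_ge0// ler_pdivrMr ?mills_den_gt0// mul1r.
by have := sqr_ge0 (t - 1); have := sqr_ge0 t; lra.
Unshelve. all: by end_near. Qed.

End GaussTail.

Section SteinFunction.
Variable R : realType.
Implicit Types y z u v t a b : R.

(* [exp (y ^ 2) * erfc y], the scaled complementary error function *)
Definition erfcx y : R := 2 / Num.sqrt pi * (expR (y ^+ 2) * gauss_tail y).

Definition stein_slope y : R := 2 / Num.sqrt pi - 2 * y * erfcx y.

Lemma sqrt_pi_gt0 : 0 < Num.sqrt pi :> R.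
Proof. by rewrite sqrtr_gt0 pi_gt0. Qed.

Let scale_ge0 : 0 <= 2 / Num.sqrt pi :> R.
Proof. by rewrite divr_ge0 ?(ltW sqrt_pi_gt0). Qed.

Let expR_gaussE y : expR (y ^+ 2) * gauss_fun y = 1.
Proof. by rewrite -expRD subrr expR0. Qed.

Lemma erfcx0 : erfcx 0 = 1.
Proof.
rewrite /erfcx gauss_tail0 expr0n expR0 mul1r.
by field; rewrite gt_eqF// sqrt_pi_gt0.
Qed.

Lemma is_derive_erfcx y : is_derive y 1 erfcx (- stein_slope y).
Proof.
have tail' := is_derive_gauss_tail y.
have exp' : is_derive y 1 (fun x : R => expR (x ^+ 2)) (2 * y * expR (y ^+ 2)).
  by apply: is_derive_eq; rewrite /GRing.scale/=; ring.
apply: is_derive_eq; rewrite /GRing.scale/= /stein_slope /erfcx.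
by rewrite mulrN expR_gaussE; ring.
Qed.

Definition stein_curvature y : R :=
  2 * (2 / Num.sqrt pi * y - (1 + 2 * y ^+ 2) * erfcx y).

Lemma is_derive_stein_slope y :
  is_derive y 1 stein_slope (stein_curvature y).
Proof.
have erfcx' := is_derive_erfcx y; apply: is_derive_eq.
by rewrite /GRing.scale/= /stein_curvature /stein_slope; ring.
Qed.

Lemma stein_slope_ge0 y : 0 <= y -> 0 <= stein_slope y.
Proof.
move=> /gauss_mills_ub/(ler_wpM2l (expR_ge0 (y ^+ 2)));
  rewrite expR_gaussE => mills.
by have := ler_wpM2l scale_ge0 mills; rewrite /stein_slope /erfcx; lra.
Qed.

Lemma erfcx_mills_lb y : 2 / Num.sqrt pi * y <= (1 + 2 * y ^+ 2) * erfcx y.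
Proof.
have := ler_wpM2l (expR_ge0 (y ^+ 2)) (gauss_mills_lb y).
rewrite mulrCA expR_gaussE => mills.
by have := ler_wpM2l scale_ge0 mills; rewrite /erfcx; lra.
Qed.

Lemma erfcx_le1 y : 0 <= y -> erfcx y <= 1.
Proof.
move=> y0; rewrite -erfcx0 -lerN2.
apply: (@ge0_is_derive_le _ (fun t => - erfcx t) stein_slope) y0 => t.
  by have erfcx' := is_derive_erfcx t; apply: is_derive_eq; rewrite opprK.
by move=> /andP[t0 _]; rewrite stein_slope_ge0// ltW.
Qed.

Lemma stein_slope_nonincreasing u v : u <= v -> stein_slope v <= stein_slope u.
Proof.
move=> uv; rewrite -lerN2.
apply: (@ge0_is_derive_le _ (fun t => - stein_slope t)
  (fun t => - stein_curvature t)) uv => t.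
  by have := is_derive_stein_slope t; exact: is_deriveN.
by have := erfcx_mills_lb t; rewrite /stein_curvature; lra.
Qed.

Lemma stein_slope_lipschitz u v : 0 <= u <= v ->
  stein_slope u <= stein_slope v + 2 * (v - u).
Proof.
move=> /andP[u0 uv].
suff : stein_slope u + 2 * u <= stein_slope v + 2 * v by lra.
apply: (@ge0_is_derive_le _ (fun t => stein_slope t + 2 * t)
  (fun t => stein_curvature t + 2)) uv => t.
  have slope' := is_derive_stein_slope t.
  by apply: is_derive_eq; rewrite /GRing.scale/=; ring.
move=> /andP[/(le_lt_trans u0)/ltW t0 _].
have erfcx1 := erfcx_le1 t0; have := mulr_ge0 t0 (stein_slope_ge0 t0).
by rewrite /stein_curvature /stein_slope; nra.
Qed.

Lemma stein_slope_norm_lipschitz y z :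
  stein_slope `|y| <= stein_slope `|z| + 2 * `|y - z|.
Proof.
have norm_dist : `| `|y| - `|z| | <= `|y - z| by exact: ler_dist_dist.
have [yz|/ltW zy] := lerP `|y| `|z|.
  have := @stein_slope_lipschitz `|y| `|z|; rewrite normr_ge0 yz => /(_ isT).
  by move: norm_dist; rewrite distrC ger0_norm ?subr_ge0//; lra.
by have := stein_slope_nonincreasing zy; have := normr_ge0 (y - z); lra.
Qed.

(* The derivative is [stein_slope `|y|], so that [stein] solves Stein's equation
   [h' y - 2 y h y = 2 / sqrt pi - 2 |y|] for a centred Gaussian of variance
   1/2. *)
Definition stein y : R := Num.sg y * (1 - erfcx `|y|).

Lemma steinN y : stein (- y) = - stein y.
Proof. by rewrite /stein sgrN normrN mulNr. Qed.

Lemma stein_equation y :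
  2 * `|y| = 2 / Num.sqrt pi + 2 * y * stein y - stein_slope `|y|.
Proof.
rewrite /stein /stein_slope mulrA -[2 * y * _]mulrA [y * _]mulrC -normrEsg.
by ring.
Qed.

Lemma ge0_stein y : 0 <= y -> stein y = 1 - erfcx y.
Proof.
rewrite /stein le_eqVlt => /predU1P[<-|y0].
  by rewrite normr0 erfcx0 subrr mulr0.
by rewrite gtr0_sg// mul1r gtr0_norm.
Qed.

Lemma ge0_stein_increment u v b : 0 <= u -> u <= v ->
  (forall t, u <= t <= v -> stein_slope `|t| <= b) ->
  stein v - stein u <= b * (v - u).
Proof.
move=> u0 uv slope_b; rewrite !ge0_stein// ?(le_trans u0)//.
suff : erfcx u + b * u <= erfcx v + b * v by lra.
apply: (@ge0_is_derive_le _ (fun t => erfcx t + b * t)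
  (fun t => - stein_slope t + b)) uv.
  move=> t; have erfcx' := is_derive_erfcx t.
  by apply: is_derive_eq; rewrite /GRing.scale/=; ring.
move=> t /andP[/ltW ut /ltW tv]; have := slope_b t.
by rewrite ut tv ger0_norm => [/(_ isT)|]; [lra|exact: le_trans u0 ut].
Qed.

Lemma le0_stein_increment u v b : u <= v -> v <= 0 ->
  (forall t, u <= t <= v -> stein_slope `|t| <= b) ->
  stein v - stein u <= b * (v - u).
Proof.
move=> uv v0 slope_b.
have slope_opp t : - v <= t <= - u -> stein_slope `|t| <= b.
  by rewrite -normrN => t_itv; apply: slope_b; lra.
have := @ge0_stein_increment (- v) (- u) b.
by rewrite oppr_ge0 lerN2 !steinN => /(_ v0 uv slope_opp); lra.
Qed.

Lemma stein_increment u v b : u <= v ->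
  (forall t, u <= t <= v -> stein_slope `|t| <= b) ->
  stein v - stein u <= b * (v - u).
Proof.
move=> uv slope_b.
have [u0|/ltW u0] := lerP 0 u; first exact: ge0_stein_increment.
have [v0|/ltW v0] := lerP v 0; first exact: le0_stein_increment.
have slope_nonneg t : 0 <= t <= v -> stein_slope `|t| <= b.
  by move=> t_itv; apply: slope_b; lra.
have slope_nonpos t : u <= t <= 0 -> stein_slope `|t| <= b.
  by move=> t_itv; apply: slope_b; lra.
have := ge0_stein_increment (lexx 0) v0 slope_nonneg.
have := le0_stein_increment u0 (lexx 0) slope_nonpos.
by rewrite (_ : stein 0 = 0); [lra|rewrite /stein sgr0 mul0r].
Qed.

(* [h (y + a) - h (y - a)] is [2 a h' z] up to second order, for any [z] within
   [a] of [y]: the only smoothness of [stein] that Stein's method uses. *)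
Lemma stein_difference y z a : `|z - y| <= `|a| ->
  a * (stein (y + a) - stein (y - a)) <=
  2 * a ^+ 2 * (stein_slope `|z| + 4 * `|a|).
Proof.
wlog a0 : a / 0 <= a => [hw|].
  have [a0|/ltW a0] := lerP 0 a; first exact: hw.
  move=> za; have := hw (- a); rewrite oppr_ge0 normrN opprK sqrrN.
  by move=> /(_ a0 za); lra.
rewrite (ger0_norm a0) => za.
have slope_near t : y - a <= t <= y + a ->
    stein_slope `|t| <= stein_slope `|z| + 4 * a.
  move=> /andP[yt ty]; apply: (le_trans (stein_slope_norm_lipschitz t z)).
  suff : `|t - z| <= 2 * a by lra.
  by move: za; rewrite !ler_norml => /andP[? ?]; apply/andP; split; lra.
have ya : y - a <= y + a by lra.
by have := ler_wpM2l a0 (stein_increment ya slope_near); lra.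
Qed.

End SteinFunction.

(** * Correlated bits and Fourier analysis on the cube *)

Lemma sum_pair (W : nmodType) (A B : finType) (f : A * B -> W) :
  \sum_x f x = \sum_a \sum_b f (a, b).
Proof. by rewrite pair_bigA; apply: eq_bigr => -[]. Qed.

Lemma sum_cst (W : pzRingType) (T : finType) (c : W) :
  \sum_(x : T) c = #|T|%:R * c.
Proof. by rewrite sumr_const mulr_natl. Qed.

Lemma sum_indicator (W : pzSemiRingType) (T : finType) (A : {set T}) :
  \sum_x (x \in A)%:R = #|A|%:R :> W.
Proof.
rewrite -sum1_card natr_sum [RHS]big_mkcond; apply: eq_bigr => x _.
by case: ifP.
Qed.

Lemma card_set_pair (W : pzSemiRingType) (S T : finType) (p : S -> T -> bool) :
  #|[set xy : S * T | p xy.1 xy.2]|%:R = \sum_x \sum_y (p x y)%:R :> W.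
Proof.
rewrite -sum_indicator sum_pair; apply: eq_bigr => x _.
by apply: eq_bigr => y _; rewrite inE.
Qed.

Lemma card_sqr (W : pzSemiRingType) (T : finType) :
  #|{: T * T}|%:R = #|T|%:R ^+ 2 :> W.
Proof. by rewrite card_prod natrM expr2. Qed.

Lemma exprNn_ge (R : realDomainType) (r : R) n : 0 <= r <= 1 ->
  - (r * (n == 1)%N%:R) - r ^+ 3 <= (- r) ^+ n.
Proof.
move=> /andP[r0 r1]; have r30 : 0 <= r ^+ 3 by exact: exprn_ge0.
case: n => [|[|n]]; rewrite ?expr0 ?expr1 ?mulr0 ?mulr1; [lra|lra|].
rewrite oppr0 sub0r exprNn -signr_odd; have [n_odd|n_even] := boolP (odd n.+2).
  by rewrite expr1 mulN1r lerN2 ler_wiXn2l//; case: n n_odd.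
by rewrite expr0 mul1r; apply: le_trans (exprn_ge0 _ r0); rewrite oppr_le0.
Qed.

Notation unit_bounded f := (forall x, `|f x| <= 1).

Section Mean.
Variables (R : numDomainType) (T : finType) (w : T -> R).
Implicit Types (f g : T -> R) (c : R).

Definition mean f : R := \sum_t w t * f t.

Lemma eq_mean f g : f =1 g -> mean f = mean g.
Proof. by move=> fg; apply: eq_bigr => t _; rewrite fg. Qed.

Lemma meanD f g : mean (fun t => f t + g t) = mean f + mean g.
Proof. by rewrite -big_split; apply: eq_bigr => t _; rewrite mulrDr. Qed.

Lemma meanZ c f : mean (fun t => c * f t) = c * mean f.
Proof. by rewrite /mean mulr_sumr; apply: eq_bigr => t _; rewrite mulrCA. Qed.

Lemma mean_sum (J : finType) (f : J -> T -> R) :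
  mean (fun t => \sum_j f j t) = \sum_j mean (f j).
Proof. by rewrite exchange_big; apply: eq_bigr => t _; rewrite mulr_sumr. Qed.

Lemma mean_cst c : \sum_t w t = 1 -> mean (fun=> c) = c.
Proof. by move=> w1; rewrite /mean -mulr_suml w1 mul1r. Qed.

Lemma le_mean f g : (forall t, 0 <= w t) -> (forall t, f t <= g t) ->
  mean f <= mean g.
Proof. by move=> w0 fg; apply: ler_sum => t _; rewrite ler_wpM2l. Qed.

End Mean.

Section QuadForm.
Variable R : realDomainType.
Implicit Types T : finType.

Definition total T (w : T -> T -> R) : R := \sum_x \sum_y w x y.

Definition quad_form T (w : T -> T -> R) (f : T -> R) : R :=
  \sum_x \sum_y w x y * (f x * f y).

(* For an adjacency kernel and signs [f], the cut given by [f] has surplus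
   [- quad_form w f / 4]. *)
Definition quad_form_lb (s : R) T (w : T -> T -> R) : Prop :=
  forall f, unit_bounded f -> - (s * total w) <= quad_form w f.

Lemma quad_form1 T (w : T -> T -> R) : quad_form w (fun=> 1) = total w.
Proof. by apply: eq_bigr => x _; apply: eq_bigr => y _; rewrite !mulr1. Qed.

Lemma norm_quad_form T (w : T -> T -> R) f : (forall x y, 0 <= w x y) ->
  unit_bounded f -> `|quad_form w f| <= total w.
Proof.
move=> w0 f1; apply: (le_trans (ler_norm_sum _ _ _)); apply: ler_sum => x _.
apply: (le_trans (ler_norm_sum _ _ _)); apply: ler_sum => y _.
by rewrite normrM ger0_norm// ler_piMr// normrM mulr_ile1.
Qed.

Lemma le_total T (w : T -> T -> R) : (forall x y, 0 <= w x y) ->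
  forall x y, w x y <= total w.
Proof.
move=> w0 x y; rewrite /total (bigD1 x)//= (bigD1 y)//= -addrA lerDl addr_ge0//.
  exact: sumr_ge0.
by apply: sumr_ge0 => x' _; exact: sumr_ge0.
Qed.

End QuadForm.

Section Cube.
Variables (R : realType) (I : finType).
Local Notation cube := {ffun I -> bool}.
Implicit Types (x y : cube) (F : cube -> R) (S : {set I}) (a : I -> R) (i : I).

Definition uniform x : R := (2 ^+ #|I|)^-1.
Local Notation cube_mean := (mean uniform).

Lemma sum_uniform : \sum_x uniform x = 1.
Proof. by rewrite sum_cst card_ffun card_bool natrX mulfV// expf_neq0. Qed.

Lemma uniform_ge0 x : 0 <= uniform x.
Proof. by rewrite invr_ge0 exprn_ge0. Qed.

Definition character S x : R := \prod_(i in S) (-1) ^+ x i.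

Definition fourier F S : R := cube_mean (fun x => F x * character S x).

(* The joint law of two uniform bits with correlation [rho]. *)
Definition noise_bit (rho : R) (t : bool * bool) : R :=
  (1 + rho * ((-1) ^+ t.1 * (-1) ^+ t.2)) / 4.

Section NoiseBit.
Variable rho : R.

Lemma sum_bool_pair (f : bool * bool -> R) : \sum_t f t =
  f (true, true) + f (true, false) + (f (false, true) + f (false, false)).
Proof. by rewrite sum_pair !big_bool. Qed.

Lemma sum_noise_bit : \sum_t noise_bit rho t = 1.
Proof. by rewrite sum_bool_pair /noise_bit/= !expr0 !expr1; field. Qed.

Lemma noise_bit_ge0 t : `|rho| <= 1 -> 0 <= noise_bit rho t.
Proof.
rewrite ler_norml => /andP[? ?]; rewrite divr_ge0//.
by case: t => -[] []; rewrite /= ?expr0 ?expr1; lra.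
Qed.

Lemma mean_noise_bit_fst : mean (noise_bit rho) (fun t => (-1) ^+ t.1) = 0.
Proof. by rewrite /mean sum_bool_pair /noise_bit/= !expr0 !expr1; field. Qed.

Lemma mean_noise_bit_snd : mean (noise_bit rho) (fun t => (-1) ^+ t.2) = 0.
Proof. by rewrite /mean sum_bool_pair /noise_bit/= !expr0 !expr1; field. Qed.

Lemma mean_noise_bit_fst_snd :
  mean (noise_bit rho) (fun t => (-1) ^+ t.1 * (-1) ^+ t.2) = rho.
Proof. by rewrite /mean sum_bool_pair /noise_bit/= !expr0 !expr1; field. Qed.

End NoiseBit.

Definition noise (rho : R) x y : R := \prod_i noise_bit rho (x i, y i).

Lemma noise_ge0 (rho : R) x y : `|rho| <= 1 -> 0 <= noise rho x y.
Proof. by move=> rho1; apply: prodr_ge0 => i _; exact: noise_bit_ge0. Qed.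

Lemma noiseC (rho : R) x y : noise rho x y = noise rho y x.
Proof. by apply: eq_bigr => i _; rewrite /noise_bit/= [(-1) ^+ _ * _]mulrC. Qed.

Lemma sum_noise (rho : R) x : \sum_y noise rho x y = uniform x.
Proof.
rewrite /noise -(bigA_distr_bigA (fun i b => noise_bit rho (x i, b)))/=.
rewrite (eq_bigr (fun=> 2^-1)) => [|i _]; first by rewrite prodr_const exprVn.
by rewrite big_bool /noise_bit/= expr0 expr1; field.
Qed.

Lemma total_noise (rho : R) : total (noise rho) = 1.
Proof.
by rewrite /total; under eq_bigr do rewrite sum_noise; exact: sum_uniform.
Qed.

Lemma noiseE (rho : R) x y : noise rho x y =
  \sum_(S : {set I})
    rho ^+ #|S| * (uniform x * character S x * (uniform y * character S y)).
Proof.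
have norm4 : \prod_(i : I) 4^-1 = (2 ^+ #|I|)^-1 * (2 ^+ #|I|)^-1 :> R.
  by rewrite prodr_const -invfM -exprMn exprVn; congr (_ ^+ _)^-1; ring.
rewrite /noise big_split/= norm4; under eq_bigr do rewrite addrC.
rewrite bigA_distr mulr_suml; apply: eq_bigr => S _.
rewrite -big_mkcond/= big_split/= prodr_const big_split/= -/(character _ _).
by rewrite /uniform /character; ring.
Qed.

Lemma quad_form_noise (rho : R) F :
  quad_form (noise rho) F = \sum_(S : {set I}) rho ^+ #|S| * fourier F S ^+ 2.
Proof.
rewrite /quad_form.
under eq_bigr => x _.
  under eq_bigr => y _ do rewrite noiseE mulr_suml.
  rewrite exchange_big/=.
over.
rewrite exchange_big/=; apply: eq_bigr => S _.
rewrite expr2 /fourier /mean mulr_suml mulr_sumr; apply: eq_bigr => x _.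
by rewrite !mulr_sumr; apply: eq_bigr => y _; ring.
Qed.

Lemma noise1 x y : noise 1 x y = (x == y)%:R * uniform x.
Proof.
have [<-|/eqP/ffunP] := eqVneq x y.
  rewrite mul1r /noise (eq_bigr (fun=> 2^-1)) => [|i _]; last first.
    by rewrite /noise_bit -expr2 sqrr_sign; field.
  by rewrite prodr_const exprVn.
move=> /existsNP[i /eqP xyi]; rewrite mul0r /noise (bigD1 i)//=.
by rewrite /noise_bit/= -signr_addb -negb_eqb xyi expr1 mul1r subrr !mul0r.
Qed.

Lemma parseval F :
  \sum_(S : {set I}) fourier F S ^+ 2 = cube_mean (fun x => F x ^+ 2).
Proof.
transitivity (quad_form (noise 1) F).
  by rewrite quad_form_noise; apply: eq_bigr => S _; rewrite expr1n mul1r.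
apply: eq_bigr => x _.
rewrite (bigD1 x)//= big1 ?addr0 => [|y /negPf yx]; last first.
  by rewrite noise1 eq_sym yx !mul0r.
by rewrite noise1 eqxx mul1r expr2.
Qed.

Definition degree1_coef F i : R := cube_mean (fun x => F x * (-1) ^+ x i).

Definition degree1_weight F : R := \sum_i degree1_coef F i ^+ 2.

Lemma degree1_weight_ge0 F : 0 <= degree1_weight F.
Proof. by apply: sumr_ge0 => i _; exact: sqr_ge0. Qed.

Lemma degree1_weightE F :
  degree1_weight F = \sum_(S : {set I} | #|S| == 1%N) fourier F S ^+ 2.
Proof.
transitivity (\sum_(S in [set [set i]%SET | i : I]%SET) fourier F S ^+ 2).
  rewrite big_imset/=; last by move=> i j _ _; exact: set1_inj.
  apply: eq_big => // i _; congr (_ ^+ 2); apply: eq_mean => x.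
  by rewrite /character big_set1.
by apply: eq_bigl => S; apply/imsetP/cards1P => [[i _ ->]|[i ->]]; exists i.
Qed.

Section BoundedFunction.
Variable F : cube -> R.
Hypothesis F_le1 : unit_bounded F.

Lemma sum_sqr_fourier_le1 : \sum_(S : {set I}) fourier F S ^+ 2 <= 1.
Proof.
rewrite parseval -[leRHS](mean_cst _ sum_uniform).
apply: (le_mean uniform_ge0) => x.
by rewrite -real_normK ?num_real// expr_le1.
Qed.

Lemma degree1_weight_le1 : degree1_weight F <= 1.
Proof.
apply: le_trans sum_sqr_fourier_le1.
rewrite degree1_weightE [leRHS](bigID (fun S : {set I} => #|S| == 1%N))/= lerDl.
by apply: sumr_ge0 => S _; exact: sqr_ge0.
Qed.

Lemma quad_form_noise_ge (r : R) : 0 <= r <= 1 ->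
  - (r * degree1_weight F) - r ^+ 3 <= quad_form (noise (- r)) F.
Proof.
move=> r01; have r30 : 0 <= r ^+ 3 by rewrite exprn_ge0//; case/andP: r01.
rewrite quad_form_noise degree1_weightE.
apply: (@le_trans _ _ (- (r * \sum_(S : {set I} | #|S| == 1%N) fourier F S ^+ 2)
    - r ^+ 3 * \sum_(S : {set I}) fourier F S ^+ 2)).
  by rewrite lerD2l lerN2 ler_piMr// sum_sqr_fourier_le1.
rewrite big_mkcond/= !mulr_sumr -sumrN -sumrB; apply: ler_sum => S _.
have := ler_wpM2r (sqr_ge0 (fourier F S)) (exprNn_ge #|S| r01).
by case: (_ == _) => /=; lra.
Qed.

End BoundedFunction.

Definition flip i x : cube := [ffun j => if j == i then ~~ x j else x j].

Lemma flipK i : involutive (flip i).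
Proof.
by move=> x; apply/ffunP => j; rewrite !ffunE; case: eqP => // _; rewrite negbK.
Qed.

Lemma mean_flip i F : cube_mean F = cube_mean (F \o flip i).
Proof. exact: (reindex_inj (inv_inj (flipK i))). Qed.

Definition rademacher a x : R := \sum_i a i * (-1) ^+ x i.

Lemma rademacher_flip a i x :
  rademacher a (flip i x) = rademacher a x - 2 * (a i * (-1) ^+ x i).
Proof.
rewrite /rademacher (bigD1 i)//= [in RHS](bigD1 i)//= ffunE eqxx signrN.
rewrite (eq_bigr (fun j => a j * (-1) ^+ x j)) => [|j /negPf ji]; first by ring.
by rewrite ffunE ji.
Qed.

Lemma stein_rademacher_coord a i (tau : R) : `|a i| <= tau ->
  cube_mean (fun x => 2 * (a i * (-1) ^+ x i) * stein (rademacher a x)) <=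
  2 * a i ^+ 2 * (cube_mean (fun x => stein_slope `|rademacher a x|) + 4 * tau).
Proof.
move=> a_le; pose term x := a i * (-1) ^+ x i * stein (rademacher a x).
have -> :
    cube_mean (fun x => 2 * (a i * (-1) ^+ x i) * stein (rademacher a x)) =
    cube_mean term + cube_mean (term \o flip i).
  rewrite -(mean_flip i term) -mulr2n -[RHS]mulr_natl -meanZ.
  by apply: eq_mean => x; rewrite /term !mulrA.
rewrite -meanD -[4 * tau](mean_cst _ sum_uniform) -meanD -meanZ.
apply: (le_mean uniform_ge0) => x.
rewrite /term/= rademacher_flip ffunE eqxx signrN.
set b := a i * (-1) ^+ x i.
have b2 : b ^+ 2 = a i ^+ 2 by rewrite exprMn sqrr_sign mulr1.
have b_norm : `|b| = `|a i| by rewrite normrM normr_sign mulr1.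
have := @stein_difference R (rademacher a x - b) (rademacher a x) b.
rewrite opprB addrCA subrr addr0 lexx subrK -b2 b_norm => /(_ isT) diff.
have -> : b * stein (rademacher a x) + a i * - (-1) ^+ x i *
    stein (rademacher a x - 2 * b) =
    b * (stein (rademacher a x) - stein (rademacher a x - b - b)).
  rewrite (_ : rademacher a x - b - b = rademacher a x - 2 * b); last by ring.
  by rewrite /b; ring.
apply: le_trans diff _; apply: ler_wpM2l; first by rewrite mulr_ge0 ?sqr_ge0.
by rewrite lerD2l ler_wpM2l.
Qed.

(* Stein's method: flipping the sign of one coordinate turns [E (X h X)] into a
   sum of symmetric differences of [h], close to [E (h' X) / 2], so that [E |X|]
   is close to the Gaussian value. *)
Lemma mean_norm_rademacher_normalized a (tau : R) :
  \sum_i a i ^+ 2 = 2^-1 -> (forall i, `|a i| <= tau) ->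
  cube_mean (fun x => `|rademacher a x|) <= (Num.sqrt pi)^-1 + 2 * tau.
Proof.
move=> a_norm a_le; set X := rademacher a.
have EXh : cube_mean (fun x => 2 * X x * stein (X x)) <=
    cube_mean (fun x => stein_slope `|X x|) + 4 * tau.
  have -> : cube_mean (fun x => 2 * X x * stein (X x)) =
      \sum_i cube_mean (fun x => 2 * (a i * (-1) ^+ x i) * stein (X x)).
    rewrite -mean_sum; apply: eq_mean => x.
    by rewrite -mulr_suml -mulr_sumr.
  apply: (le_trans (ler_sum _ (fun i _ => stein_rademacher_coord (a_le i)))).
  by rewrite -mulr_suml -mulr_sumr a_norm mulfV ?pnatr_eq0// mul1r.
suff : 2 * cube_mean (fun x => `|X x|) <= 2 / Num.sqrt pi + 4 * tau by lra.
have E_stein_equation : 2 * cube_mean (fun x => `|X x|) +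
    cube_mean (fun x => stein_slope `|X x|) =
    2 / Num.sqrt pi + cube_mean (fun x => 2 * X x * stein (X x)).
  rewrite -meanZ -meanD -[2 / _](mean_cst _ sum_uniform) -meanD.
  by apply: eq_mean => x; rewrite stein_equation; ring.
lra.
Qed.

Lemma mean_norm_rademacher a (tau : R) : 0 <= tau ->
  (forall i, `|a i| <= tau) ->
  cube_mean (fun x => `|rademacher a x|) <=
  Num.sqrt (2 / pi * \sum_i a i ^+ 2) + 2 * tau.
Proof.
move=> tau0 a_le; set V := \sum_i _.
have V0 : 0 <= V by apply: sumr_ge0 => i _; exact: sqr_ge0.
have [V_eq0|V_neq0] := eqVneq V 0.
  have a0 i : a i = 0.
    apply/eqP; rewrite -sqrf_eq0.
    by rewrite (psumr_eq0P (fun i _ => sqr_ge0 (a i)) V_eq0).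
  have rademacher0 x : `|rademacher a x| = 0.
    by rewrite /rademacher big1 ?normr0// => i _; rewrite a0 mul0r.
  rewrite V_eq0 mulr0 sqrtr0 add0r (eq_mean _ rademacher0).
  by rewrite (mean_cst _ sum_uniform) mulr_ge0.
have V2_gt0 : 0 < 2 * V by rewrite mulr_gt0// lt0r V_neq0.
set n := Num.sqrt (2 * V); have n_gt0 : 0 < n by rewrite sqrtr_gt0.
have n2 : n ^+ 2 = 2 * V by rewrite sqr_sqrtr// ltW.
have normalized : \sum_i (a i / n) ^+ 2 = 2^-1.
  under eq_bigr do rewrite exprMn exprVn n2.
  by rewrite -mulr_suml -/V; field.
have normalized_le i : `|a i / n| <= tau / n.
  by rewrite normrM [`|n^-1|]gtr0_norm ?invr_gt0// ler_pM2r ?invr_gt0.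
have := mean_norm_rademacher_normalized normalized normalized_le.
have rademacherZ x :
    `|rademacher (fun i => a i / n) x| = n^-1 * `|rademacher a x|.
  rewrite -[in RHS](gtr0_norm (_ : 0 < n^-1)) ?invr_gt0// -normrM.
  by congr `|_|; rewrite /rademacher mulr_sumr; apply: eq_bigr => i _; ring.
have -> : Num.sqrt (2 / pi * V) = n * (Num.sqrt pi)^-1.
  by rewrite -sqrtrV ?pi_ge0// -sqrtrM ?(ltW V2_gt0)//; congr Num.sqrt; ring.
rewrite (eq_mean _ rademacherZ) meanZ ler_pdivrMl// mulrDr.
by rewrite (_ : n * (2 * (tau / n)) = 2 * tau)//; field; rewrite gt_eqF.
Qed.

(* AM-GM absorbs the square root: if [W] is the weight and [X] the linear part
   of [F], then [W = E (F X) <= E |X| <= (2 / pi + W) / 2 + 2 tau]. *)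
Lemma degree1_weight_le F (tau : R) : 0 <= tau -> unit_bounded F ->
  (forall i, `|degree1_coef F i| <= tau) ->
  degree1_weight F <= 2 / pi + 4 * tau.
Proof.
move=> tau0 F_le1 coef_le; set W := degree1_weight F.
have W_le : W <= cube_mean (fun x => `|rademacher (degree1_coef F) x|).
  have -> : W = cube_mean (fun x => F x * rademacher (degree1_coef F) x).
    under eq_mean do rewrite mulr_sumr.
    rewrite mean_sum; apply: eq_bigr => i _.
    rewrite expr2 {1}/degree1_coef mulrC -meanZ.
    by apply: eq_mean => x; ring.
  apply: (le_mean uniform_ge0) => x; apply: (le_trans (ler_norm _)).
  by rewrite normrM ler_piMl.
have := le_trans W_le (mean_norm_rademacher tau0 coef_le); rewrite -/W.
have pi2_ge0 : 0 <= 2 / pi :> R by rewrite divr_ge0 ?pi_ge0.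
have W0 : 0 <= W by exact: degree1_weight_ge0.
have [+ _] := leif_mean_square (Num.sqrt (2 / pi)) (Num.sqrt W).
by rewrite -sqrtrM// !sqr_sqrtr//; lra.
Qed.

End Cube.

(** * Independent samples *)

Section IndependentSamples.
Variables (R : realFieldType) (J T : finType) (w : T -> R).
Hypothesis w_sum1 : \sum_t w t = 1.
Implicit Types (g h : T -> R) (om : {ffun J -> T}) (i j : J).

Definition prodw om : R := \prod_j w (om j).

Lemma sum_prodw : \sum_om prodw om = 1.
Proof. by rewrite /prodw -(bigA_distr_bigA (fun=> w)) big1. Qed.

Lemma mean_prodw_prod (g : J -> T -> R) :
  mean prodw (fun om => \prod_j g j (om j)) = \prod_j mean w (g j).
Proof.
by rewrite /mean bigA_distr_bigA/=; apply: eq_bigr => om _; rewrite -big_split.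
Qed.

Lemma mean_prodw_coord j g : mean prodw (fun om => g (om j)) = mean w g.
Proof.
pose factor i t := if i == j then g t else 1.
transitivity (mean prodw (fun om => \prod_i factor i (om i))).
  apply: eq_mean => om; rewrite (bigD1 j)//= /factor eqxx big1 ?mulr1//.
  by move=> i /negPf ->.
rewrite mean_prodw_prod (bigD1 j)//= [X in _ * X]big1 ?mulr1.
  by apply: eq_mean => t; rewrite /factor eqxx.
move=> i /negPf ij; rewrite -[RHS](mean_cst 1 w_sum1).
by apply: eq_mean => t; rewrite /factor ij.
Qed.

Lemma mean_prodw_coord2 i j g h : i != j ->
  mean prodw (fun om => g (om i) * h (om j)) = mean w g * mean w h.
Proof.
move=> ij; have ji : (j == i) = false by rewrite eq_sym (negPf ij).
pose factor l t := if l == i then g t else if l == j then h t else 1.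
transitivity (mean prodw (fun om => \prod_l factor l (om l))).
  apply: eq_mean => om; rewrite (bigD1 i)//= (bigD1 j) ?ji//= /factor.
  by rewrite eqxx ji eqxx big1 ?mulr1// => l /andP[/negPf -> /negPf ->].
rewrite mean_prodw_prod (bigD1 i)//= (bigD1 j) ?ji//=.
rewrite [X in _ * (_ * X)]big1 ?mulr1.
  by congr (_ * _); apply: eq_mean => t; rewrite /factor ?ji eqxx.
move=> l /andP[/negPf li /negPf lj]; rewrite -[RHS](mean_cst 1 w_sum1).
by apply: eq_mean => t; rewrite /factor li lj.
Qed.

Lemma mean_mul_sum_prodw g h : mean w g = 0 ->
  mean prodw (fun om => (\sum_i g (om i)) * \sum_j h (om j)) =
  #|J|%:R * mean w (fun t => g t * h t).
Proof.
move=> g0.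
transitivity (\sum_i \sum_j mean prodw (fun om => g (om i) * h (om j))).
  under eq_bigr do rewrite -mean_sum; rewrite -mean_sum; apply: eq_mean => om.
  by rewrite mulr_suml; apply: eq_bigr => i _; rewrite mulr_sumr.
rewrite -sum_cst; apply: eq_bigr => i _.
rewrite (bigD1 i)//= [X in _ + X]big1 ?addr0.
  exact: (mean_prodw_coord i (fun t => g t * h t)).
by move=> j ji; rewrite mean_prodw_coord2 1?eq_sym// g0 mul0r.
Qed.

Lemma chebyshev_prodw g (m B : R) :
  (forall t, 0 <= w t) -> (0 < #|J|)%N -> 0 < m ->
  mean w g = - m -> (forall t, (g t + m) ^+ 2 <= B) ->
  mean prodw (fun om => (0 <= \sum_j g (om j))%R%:R) <= B / (#|J|%:R * m ^+ 2).
Proof.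
move=> w_ge0 J_gt0 m_gt0 g_mean g_var.
have J_gt0R : 0 < #|J|%:R :> R by rewrite ltr0n.
pose mu := #|J|%:R * m; have mu_gt0 : 0 < mu by rewrite mulr_gt0.
have prodw_ge0 om : 0 <= prodw om by apply: prodr_ge0.
pose dev om := \sum_j (g (om j) + m).
have dev_mean : mean w (fun t => g t + m) = 0.
  by rewrite meanD g_mean mean_cst// addNr.
apply: (@le_trans _ _
    (mean prodw (fun om => (mu ^+ 2)^-1 * (dev om * dev om)))).
  apply: (le_mean prodw_ge0) => om; have devE : dev om = \sum_j g (om j) + mu.
    by rewrite /dev big_split/= sum_cst.
  have [S_ge0|_] := lerP 0 (\sum_j g (om j)); last first.
    by rewrite mulr_ge0 ?invr_ge0 ?sqr_ge0.
  rewrite ler_pdivlMl ?exprn_gt0// mulr1 -expr2 devE.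
  by rewrite ler_pXn2r ?nnegrE ?addr_ge0 ?(ltW mu_gt0)// lerDr.
have dev_var : mean prodw (fun om => dev om * dev om) =
    #|J|%:R * mean w (fun t => (g t + m) ^+ 2) by exact: mean_mul_sum_prodw.
rewrite meanZ dev_var.
apply: (@le_trans _ _ ((mu ^+ 2)^-1 * (#|J|%:R * B))).
  rewrite ler_pM2l ?invr_gt0 ?exprn_gt0// ler_pM2l//.
  rewrite -[leRHS](mean_cst B w_sum1).
  by apply: (le_mean w_ge0) => t; exact: g_var.
rewrite (_ : _ * (_ * B) = B / (#|J|%:R * m ^+ 2))// /mu.
by field; rewrite !gt_eqF.
Qed.

End IndependentSamples.

(** * Weighted graphs and vector colourings *)

Section PushForward.
Variables (R : realDomainType) (T U : finType) (h : T -> U) (w : T -> T -> R).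

Definition push u v : R := \sum_(x | h x == u) \sum_(y | h y == v) w x y.

Lemma sum_push (g : U -> U -> R) : \sum_u \sum_v push u v * g u v =
  \sum_x \sum_y w x y * g (h x) (h y).
Proof.
rewrite [RHS](partition_big h xpredT)//=; apply: eq_bigr => u _.
under [RHS]eq_bigr => x _ do rewrite (partition_big h xpredT)//=.
rewrite [RHS]exchange_big/=; apply: eq_bigr => v _.
rewrite /push mulr_suml; apply: eq_bigr => x /eqP ->.
by rewrite mulr_suml; apply: eq_bigr => y /eqP ->.
Qed.

Lemma quad_form_push (g : U -> R) : quad_form push g = quad_form w (g \o h).
Proof. exact: (sum_push (fun u v => g u * g v)). Qed.

Lemma total_push : total push = total w.
Proof. by rewrite -!quad_form1 quad_form_push. Qed.

Lemma push_ge0 : (forall x y, 0 <= w x y) -> forall u v, 0 <= push u v.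
Proof. by move=> w0 u v; do 2 (apply: sumr_ge0 => ? _). Qed.

Lemma pushC : (forall x y, w x y = w y x) -> forall u v, push u v = push v u.
Proof.
move=> wC u v; rewrite /push exchange_big/=.
by apply: eq_bigr => x _; apply: eq_bigr => y _.
Qed.

End PushForward.

Record wgraph (R : realType) := WGraph {
  wvertex :> finType;
  weight : wvertex -> wvertex -> R;
  weight_ge0 : forall u v, 0 <= weight u v;
  weight_le1 : forall u v, weight u v <= 1;
  weightC : forall u v, weight u v = weight v u;
  weight_diag : forall u, weight u u = 0 }.

Definition vector_coloring (R : realType) (T : Type) (e : rel T) (c : R)
    (d : nat) (x : T -> 'rV[R]_d) : Prop :=
  (forall u, dotp (x u) (x u) = 1) /\
  (forall u v, e u v -> dotp (x u) (x v) <= - c).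

Section InnerProduct.
Variables (R : realType) (d : nat).
Implicit Types (u v : 'rV[R]_d) (k : R).

Lemma dotpC u v : dotp u v = dotp v u.
Proof. by apply: eq_bigr => i _; rewrite mulrC. Qed.

Lemma dotpZl k u v : dotp (k *: u) v = k * dotp u v.
Proof.
by rewrite /dotp mulr_sumr; apply: eq_bigr => i _; rewrite mxE mulrA.
Qed.

Lemma dotpZr k u v : dotp u (k *: v) = k * dotp u v.
Proof. by rewrite dotpC dotpZl dotpC. Qed.

Lemma dotp0r u : dotp u 0 = 0.
Proof. by rewrite -(scale0r 0) dotpZr mul0r. Qed.

Lemma dotp0l u : dotp 0 u = 0.
Proof. by rewrite dotpC dotp0r. Qed.

Lemma dotp_ge0 u : 0 <= dotp u u.
Proof. by apply: sumr_ge0 => i _; rewrite -expr2 sqr_ge0. Qed.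

Lemma dotp_eq0 u : (dotp u u == 0) = (u == 0).
Proof.
apply/idP/eqP => [/eqP u0|->]; last by rewrite dotp0r.
apply/rowP => i; apply/eqP; rewrite mxE -sqrf_eq0 expr2.
by rewrite (psumr_eq0P _ u0)// => j _; rewrite -expr2 sqr_ge0.
Qed.

Lemma dotp_gt0 u : (0 < dotp u u) = (u != 0).
Proof. by rewrite lt0r dotp_eq0 dotp_ge0 andbT. Qed.

Lemma dotp_sum (I J : finType) (x : I -> 'rV[R]_d) (y : J -> 'rV[R]_d) :
  dotp (\sum_i x i) (\sum_j y j) = \sum_i \sum_j dotp (x i) (y j).
Proof.
under [RHS]eq_bigr do rewrite exchange_big.
rewrite exchange_big; apply: eq_bigr => l _; rewrite !summxE mulr_suml.
by apply: eq_bigr => i _; rewrite mulr_sumr.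
Qed.

End InnerProduct.

Lemma dotp_row_mx (R : realType) (m n : nat) (u v : 'rV[R]_m) (u' v' : 'rV_n) :
  dotp (row_mx u u') (row_mx v v') = dotp u v + dotp u' v'.
Proof.
rewrite /dotp big_split_ord; congr (_ + _); apply: eq_bigr => i _.
  by rewrite !row_mxEl.
by rewrite !row_mxEr.
Qed.

(* Vertices carrying vectors [z u] are joined only when the inner product is
   negative enough: by AM-GM, [gap u v < 0] forces
   [<z u, z v> <= - c |z u| |z v|]. *)
Section Truncation.
Variables (R : realType) (V : finType) (d : nat) (z : V -> 'rV[R]_d.+1) (c : R).
Variable w : V -> V -> R.
Hypothesis c_gt0 : 0 < c.
Hypothesis w_ge0 : forall u v, 0 <= w u v.
Hypothesis wC : forall u v, w u v = w v u.
Hypothesis w_total : total w = 1.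

Definition gap u v : R :=
  dotp (z u) (z v) + c / 2 * (dotp (z u) (z u) + dotp (z v) (z v)).

Let half_sqnorms_ge0 (x y : 'rV[R]_d.+1) : 0 <= c / 2 * (dotp x x + dotp y y).
Proof. by rewrite mulr_ge0 ?addr_ge0 ?dotp_ge0// divr_ge0// ltW. Qed.

Definition truncated_weight u v : R := (gap u v < 0)%R%:R * w u v.

Definition discarded_mass : R := \sum_u \sum_v w u v * (0 <= gap u v)%R%:R.

Lemma truncated_weight_ge0 u v : 0 <= truncated_weight u v.
Proof. exact: mulr_ge0. Qed.

Lemma truncated_weight_le1 u v : truncated_weight u v <= 1.
Proof.
rewrite -w_total; apply: le_trans (le_total w_ge0 u v).
by rewrite ler_piMl// lern1 leq_b1.
Qed.

Lemma truncated_weightC u v : truncated_weight u v = truncated_weight v u.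
Proof.
by rewrite /truncated_weight /gap wC dotpC [dotp (z u) (z u) + _]addrC.
Qed.

Lemma truncated_weight_diag u : truncated_weight u u = 0.
Proof.
rewrite /truncated_weight ltNge; suff -> : 0 <= gap u u by rewrite mul0r.
by rewrite addr_ge0 ?dotp_ge0 ?half_sqnorms_ge0.
Qed.

Definition truncated_graph : wgraph R :=
  WGraph truncated_weight_ge0 truncated_weight_le1 truncated_weightC
    truncated_weight_diag.

Lemma quad_form_truncated_ge (g : V -> R) : unit_bounded g ->
  quad_form w g - discarded_mass <= quad_form truncated_weight g.
Proof.
move=> g1; rewrite -sumrB; apply: ler_sum => u _.
rewrite -sumrB; apply: ler_sum => v _.
rewrite /truncated_weight ltNge; have [_|_] := lerP 0 (gap u v); last first.
  by rewrite mulr0 subr0 mul1r.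
rewrite mulr1 !mul0r subr_le0 ler_piMr// (le_trans (ler_norm _))// normrM.
exact: mulr_ile1.
Qed.

Lemma total_truncated_ge : 1 - discarded_mass <= total truncated_weight.
Proof.
by rewrite -w_total -!quad_form1 quad_form_truncated_ge// => u; rewrite normr1.
Qed.

Definition unit_vector u : 'rV[R]_d.+1 :=
  if z u == 0 then delta_mx 0 0 else (Num.sqrt (dotp (z u) (z u)))^-1 *: z u.

Lemma dotp_unit_vector u : dotp (unit_vector u) (unit_vector u) = 1.
Proof.
rewrite /unit_vector; case: ifPn => [_|z0].
  rewrite /dotp (bigD1 0)//= big1 ?addr0; first by rewrite !mxE !eqxx mulr1.
  by move=> i /negPf i0; rewrite !mxE i0 andbF mul0r.
rewrite dotpZl dotpZr mulrA -expr2 exprVn sqr_sqrtr ?dotp_ge0// mulVf//.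
by rewrite dotp_eq0.
Qed.

Lemma dotp_unit_vector_le u v : gap u v < 0 ->
  dotp (unit_vector u) (unit_vector v) <= - c.
Proof.
move=> gap_lt0; have zu : z u != 0.
  apply: contraTneq gap_lt0 => zu0; rewrite -leNgt.
  by rewrite /gap zu0 dotp0l add0r half_sqnorms_ge0.
have zv : z v != 0.
  apply: contraTneq gap_lt0 => zv0; rewrite -leNgt.
  by rewrite /gap zv0 dotp0r add0r half_sqnorms_ge0.
rewrite /unit_vector (negPf zu) (negPf zv) dotpZl dotpZr.
have nu : 0 < Num.sqrt (dotp (z u) (z u)) by rewrite sqrtr_gt0 dotp_gt0.
have nv : 0 < Num.sqrt (dotp (z v) (z v)) by rewrite sqrtr_gt0 dotp_gt0.
rewrite ler_pdivrMl// ler_pdivrMl//; move: gap_lt0; rewrite /gap.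
set a := Num.sqrt _ in nu *; set b := Num.sqrt _ in nv *.
have -> : dotp (z u) (z u) = a ^+ 2 by rewrite sqr_sqrtr ?dotp_ge0.
have -> : dotp (z v) (z v) = b ^+ 2 by rewrite sqr_sqrtr ?dotp_ge0.
have := mulr_ge0 (ltW c_gt0) (sqr_ge0 (a - b)); lra.
Qed.

Lemma vector_coloring_truncated :
  vector_coloring [rel u v | 0 < truncated_weight u v] c unit_vector.
Proof.
split=> [u|u v /=]; first exact: dotp_unit_vector.
rewrite /truncated_weight; have [/dotp_unit_vector_le//|_] := ltrP (gap u v) 0.
by rewrite mul0r ltxx.
Qed.

End Truncation.

(** * The weighted graph of block sums *)

Section NoiseBlocks.
Variables (R : realType) (D k : nat) (r : R).
Hypotheses (r01 : 0 <= r <= 1) (k0 : (0 < k)%N).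
Local Notation I := ('I_D.+1 * 'I_k)%type.
Local Notation cube := {ffun I -> bool}.
Local Notation block := {ffun 'I_k -> bool * bool}.
Local Notation V := {ffun 'I_D.+1 -> 'I_k.+1}.
Implicit Types (x y : cube) (u v : V) (t : block).
Implicit Types om : {ffun 'I_D.+1 -> block}.

Local Notation bit_law := (noise_bit (- r)).
Local Notation block_law := (@prodw R 'I_k _ bit_law).

Let bit_law_sum : \sum_t bit_law t = 1 := sum_noise_bit (- r).
Let block_law_sum : \sum_t block_law t = 1 := sum_prodw 'I_k bit_law_sum.

Definition left_bits om : cube := [ffun p => (om p.1 p.2).1].
Definition right_bits om : cube := [ffun p => (om p.1 p.2).2].

Lemma sum_left_right_bits (f : cube -> cube -> R) :
  \sum_x \sum_y f x y = \sum_om f (left_bits om) (right_bits om).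
Proof.
rewrite -(sum_pair (fun xy => f xy.1 xy.2)).
rewrite (reindex (fun om => (left_bits om, right_bits om)))//=.
exists (fun xy : cube * cube =>
  [ffun b : 'I_D.+1 => [ffun i : 'I_k => (xy.1 (b, i), xy.2 (b, i))]]).
  move=> om _; apply/ffunP => b; apply/ffunP => i.
  by rewrite !ffunE /= -surjective_pairing.
by move=> [x y] _; congr pair; apply/ffunP => -[b i]; rewrite !ffunE.
Qed.

Lemma noise_left_right_bits om :
  noise (- r) (left_bits om) (right_bits om) = prodw block_law om.
Proof.
rewrite /noise /prodw pair_bigA; apply: eq_bigr => -[b i] _.
by rewrite !ffunE /= -surjective_pairing.
Qed.

Lemma mean_left_right_bits (f : cube -> cube -> R) :
  \sum_x \sum_y noise (- r) x y * f x y =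
  mean (prodw block_law) (fun om => f (left_bits om) (right_bits om)).
Proof.
rewrite sum_left_right_bits; apply: eq_bigr => om _.
by rewrite noise_left_right_bits.
Qed.

(* Vertices only see the block sums of [x]: this makes the degree-one
   coefficients of a cut constant on blocks and rules out the dictator cuts of
   the cube. *)
Definition counts x : V := [ffun b => inord (\sum_(i < k) x (b, i))%N].

Definition centred u : 'rV[R]_D.+1 := \row_b (k%:R - 2 * (u b)%:R).

Lemma centred_counts x b :
  centred (counts x) 0 b = \sum_(i < k) (-1) ^+ x (b, i).
Proof.
rewrite mxE ffunE inordK; last first.
  rewrite ltnS -[leqRHS]card_ord -sum1_card; apply: leq_sum => i _.
  exact: leq_b1.
have -> : k%:R = \sum_(i < k) 1 :> R by rewrite sum_cst card_ord mulr1.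
rewrite natr_sum mulr_sumr -sumrB; apply: eq_bigr => i _.
by case: (x (b, i)); rewrite ?expr0 ?expr1 /=; ring.
Qed.

Definition block_kernel : V -> V -> R := push counts (noise (- r)).

Lemma total_block_kernel : total block_kernel = 1.
Proof. by rewrite total_push total_noise. Qed.

Section BlockGap.
Variable c : R.
Hypothesis c0r : 0 < c < r.

Definition block_gap t : R :=
  let z := \sum_i (-1) ^+ (t i).1 in let z' := \sum_i (-1) ^+ (t i).2 in
  z * z' + c / 2 * (z * z + z' * z').

Lemma gap_counts om :
  gap centred c (counts (left_bits om)) (counts (right_bits om)) =
  \sum_b block_gap (om b).
Proof.
have left_sum b :
    centred (counts (left_bits om)) 0 b = \sum_i (-1) ^+ (om b i).1.
  by rewrite centred_counts; apply: eq_bigr => i _; rewrite ffunE.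
have right_sum b :
    centred (counts (right_bits om)) 0 b = \sum_i (-1) ^+ (om b i).2.
  by rewrite centred_counts; apply: eq_bigr => i _; rewrite ffunE.
rewrite /gap /dotp -big_split mulr_sumr -big_split; apply: eq_bigr => b _.
by rewrite !left_sum !right_sum.
Qed.

Lemma mean_block_gap : mean block_law block_gap = - (k%:R * (r - c)).
Proof.
have zz := mean_mul_sum_prodw 'I_k bit_law_sum (fun p => (-1) ^+ p.1)
  (mean_noise_bit_fst (- r)).
have zz' := mean_mul_sum_prodw 'I_k bit_law_sum (fun p => (-1) ^+ p.2)
  (mean_noise_bit_fst (- r)).
have z'z' := mean_mul_sum_prodw 'I_k bit_law_sum (fun p => (-1) ^+ p.2)
  (mean_noise_bit_snd (- r)).
have mean_sqr (f : bool * bool -> bool) :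
    mean bit_law (fun p => (-1) ^+ f p * (-1) ^+ f p) = 1.
  rewrite -[RHS](mean_cst 1 bit_law_sum); apply: eq_mean => p.
  by rewrite -expr2 sqrr_sign.
rewrite card_ord ?mean_sqr ?mean_noise_bit_fst_snd in zz zz' z'z'.
rewrite /block_gap meanD zz' meanZ meanD zz z'z'; lra.
Qed.

(* A crude bound is enough, since [D] is chosen after [k]. *)
Lemma block_gap_dev_le t : (block_gap t + k%:R * (r - c)) ^+ 2 <= 9 * k%:R ^+ 4.
Proof.
have sum_sign_le (f : 'I_k -> bool) : `|\sum_i (-1) ^+ f i| <= k%:R :> R.
  apply: (le_trans (ler_norm_sum _ _ _)).
  by under eq_bigr do rewrite normr_sign; rewrite sum_cst card_ord mulr1.
have k1 : 1 <= k%:R :> R by rewrite ler1n.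
case/andP: c0r => c0 cr; case/andP: r01 => _ r_le1.
have rc1 : r - c <= 1 by lra.
have mean_le : 0 <= k%:R * (r - c) <= k%:R ^+ 2.
  by rewrite mulr_ge0 ?subr_ge0 ?(ltW cr)//= expr2 ler_wpM2l// (le_trans rc1).
rewrite /block_gap; set z := \sum_i _; set z' := \sum_i _.
set K := k%:R in sum_sign_le k1 mean_le *.
have prod_le (s s' : R) : `|s| <= K -> `|s'| <= K -> `|s * s'| <= K ^+ 2.
  by move=> sK s'K; rewrite normrM expr2 ler_pM.
have := prod_le z z' (sum_sign_le _) (sum_sign_le _).
have := prod_le z z (sum_sign_le _) (sum_sign_le _).
have := prod_le z' z' (sum_sign_le _) (sum_sign_le _).
have sqr_norms (s : R) : `|s * s| = s * s by rewrite ger0_norm// -expr2 sqr_ge0.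
rewrite !sqr_norms => zz z'z' zz'.
have -> : 9 * K ^+ 4 = (3 * K ^+ 2) ^+ 2 by ring.
rewrite -(real_normK (num_real (_ + _))) ler_pXn2r ?nnegrE//; last nra.
have norms_le : 0 <= c / 2 * (z * z + z' * z') <= K ^+ 2.
  have := sqr_ge0 z; have := sqr_ge0 z'; rewrite !expr2 => z'2 z2.
  have : c * (z * z + z' * z') <= z * z + z' * z' by rewrite ler_piMl; lra.
  by have := mulr_ge0 (ltW c0) (addr_ge0 z2 z'2); lra.
move: zz' norms_le mean_le; rewrite !ler_norml.
move=> /andP[? ?] /andP[? ?] /andP[? ?].
by apply/andP; split; lra.
Qed.

Lemma discarded_mass_block_le : discarded_mass centred c block_kernel <=
  9 * k%:R ^+ 4 / (D.+1%:R * (k%:R * (r - c)) ^+ 2).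
Proof.
pose bad u v : R := (0 <= gap centred c u v)%R%:R.
rewrite /discarded_mass (sum_push _ _ bad).
rewrite (mean_left_right_bits (fun x y => bad (counts x) (counts y))) /bad.
under eq_mean do rewrite gap_counts; rewrite -[D.+1 in leRHS]card_ord.
apply: (chebyshev_prodw block_law_sum).
- move=> t; apply: prodr_ge0 => i _; apply: noise_bit_ge0.
  by rewrite normrN ger0_norm; case/andP: r01.
- by rewrite card_ord.
- by case/andP: c0r => _ cr; rewrite mulr_gt0 ?ltr0n// subr_gt0.
- exact: mean_block_gap.
- exact: block_gap_dev_le.
Qed.

End BlockGap.

Lemma degree1_coef_counts (g : V -> R) b i i' :
  degree1_coef (g \o counts) (b, i) = degree1_coef (g \o counts) (b, i').
Proof.
pose swap x : cube :=
  [ffun p => if p.1 == b then x (p.1, tperm i i' p.2) else x p].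
have swapK : involutive swap.
  move=> x; apply/ffunP => -[b' j]; rewrite !ffunE /=.
  by case: eqP => // ->; rewrite tpermK.
have counts_swap x : counts (swap x) = counts x.
  apply/ffunP => b'; rewrite !ffunE; congr inord.
  case: (eqVneq b' b) => [->|/negPf b'b]; last first.
    by apply: eq_bigr => j _; rewrite ffunE /= b'b.
  rewrite [RHS](reindex_inj (@perm_inj _ (tperm i i')))/=.
  by apply: eq_bigr => j _; rewrite ffunE /= eqxx.
rewrite /degree1_coef /mean (reindex_inj (inv_inj swapK))/=.
apply: eq_bigr => x _.
by rewrite counts_swap [swap x (b, i)]ffunE /= eqxx tpermL.
Qed.

Lemma quad_form_block_ge (g : V -> R) (tau : R) :
  0 <= tau -> 1 <= k%:R * tau ^+ 2 -> unit_bounded g ->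
  - (r * (2 / pi + 4 * tau)) - r ^+ 3 <= quad_form block_kernel g.
Proof.
move=> tau0 k_tau g1; rewrite quad_form_push; pose F := g \o counts.
have F1 x : `|F x| <= 1 by exact: g1.
apply: le_trans (quad_form_noise_ge F1 r01); case/andP: r01 => r0 _.
rewrite lerD2r lerN2 ler_wpM2l// degree1_weight_le// => -[b i].
have coef2_le : k%:R * degree1_coef F (b, i) ^+ 2 <= 1.
  apply: le_trans (degree1_weight_le1 F1).
  rewrite /degree1_weight sum_pair (bigD1 b)//= -[leLHS]addr0 lerD//.
    rewrite -{1}[k]card_ord -sum_cst; apply: ler_sum => i' _.
    by rewrite (degree1_coef_counts g b i i').
  by do 2 (apply: sumr_ge0 => ? _); exact: sqr_ge0.
rewrite -(@ler_pXn2r _ 2)// ?nnegrE// real_normK ?num_real//.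
by rewrite -(@ler_pM2l _ k%:R) ?ltr0n// (le_trans coef2_le).
Qed.

End NoiseBlocks.

Lemma exists_natS_ge (R : archiRealDomainType) (a : R) :
  exists n : nat, a <= n.+1%:R.
Proof.
exists (Num.bound `|a|); apply: (le_trans (ler_norm a)).
by apply/ltW/(lt_le_trans (archi_boundP (normr_ge0 a))); rewrite ler_nat.
Qed.

Lemma exists_quad_form_ge_wgraph (R : realType) (r c eta : R) :
  0 < c < r -> r <= 1 -> 0 < eta ->
  exists (P : wgraph R) (d : nat) (x : P -> 'rV[R]_d),
    [/\ vector_coloring [rel u v | 0 < weight u v] c x,
        1 - eta <= total (@weight R P) &
        forall g : P -> R, unit_bounded g ->
          - (r * (2 / pi) + r ^+ 3 + 2 * eta) <= quad_form (@weight R P) g].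
Proof.
move=> c0r r1 eta0; case/andP: (c0r) => c0 cr; have r0 := lt_trans c0 cr.
have r01 : 0 <= r <= 1 by rewrite ltW.
pose tau := eta / 4; have tau0 : 0 < tau by rewrite divr_gt0.
have [k k_tau] := exists_natS_ge (tau ^- 2).
pose m := k.+1%:R * (r - c); have m0 : 0 < m by rewrite mulr_gt0// subr_gt0.
have [D D_eta] := exists_natS_ge (9 * k.+1%:R ^+ 4 / (eta * m ^+ 2)).
pose w : {ffun 'I_D.+1 -> 'I_k.+2} -> _ -> R := block_kernel r.
pose z := @centred R D k.+1.
have w_ge0 u v : 0 <= w u v.
  by apply: push_ge0 => x y; rewrite noise_ge0// normrN ger0_norm// ltW.
have wC u v : w u v = w v u by apply: pushC; exact: noiseC.
have w_total : total w = 1 := total_block_kernel D k.+1 r.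
have mass_le : discarded_mass z c w <= eta.
  apply: (le_trans (discarded_mass_block_le D r01 (ltn0Sn k) c0r)).
  move: D_eta; rewrite -/m !ler_pdivrMr ?mulr_gt0 ?exprn_gt0//; lra.
exists (truncated_graph z c0 w_ge0 wC w_total), D.+1, (unit_vector z); split.
- exact: vector_coloring_truncated.
- apply: le_trans (total_truncated_ge z c w_ge0 w_total).
  by rewrite lerD2l lerN2.
move=> g g1; apply: le_trans (quad_form_truncated_ge z c w_ge0 g1).
have tau_k : 1 <= k.+1%:R * tau ^+ 2 by rewrite -ler_pdivrMr ?exprn_gt0// mul1r.
have := quad_form_block_ge r01 (ltn0Sn k) (ltW tau0) tau_k g1.
have : r * eta <= eta by rewrite ler_piMl// ltW.
rewrite /tau -/w; lra.
Qed.

Lemma exists_quad_form_lb_wgraph (R : realType) (r c s : R) :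
  0 < c < r -> r <= 1 -> r * (2 / pi) + r ^+ 3 < s ->
  exists (P : wgraph R) (d : nat) (x : P -> 'rV[R]_d),
    [/\ vector_coloring [rel u v | 0 < weight u v] c x,
        0 < total (@weight R P) & quad_form_lb s (@weight R P)].
Proof.
move=> c0r r1; set b := _ + _ => bs.
have r0 : 0 < r by case/andP: c0r => c0; exact: lt_trans.
have b0 : 0 < b by rewrite addr_gt0 ?exprn_gt0// mulr_gt0// divr_gt0 ?pi_gt0.
have s0 := lt_trans b0 bs.
pose eta := (s - b) / (s + 2).
have etaE : s * eta + 2 * eta = s - b.
  by rewrite /eta; field; rewrite gt_eqF; lra.
have eta0 : 0 < eta by rewrite divr_gt0//; lra.
have eta1 : eta < 1 by rewrite ltr_pdivrMr; lra.
have [P [d [x [x_col tot_ge form_ge]]]] :=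
  exists_quad_form_ge_wgraph c0r r1 eta0.
exists P, d, x; split=> //; first lra.
move=> g /form_ge; rewrite -/b; have := ler_wpM2l (ltW s0) tot_ge; lra.
Qed.

(** * Pseudo-random blow-up of a weighted graph *)

Lemma sum_cauchy_schwarz (R : realDomainType) (T : finType) (a b : T -> R) :
  (\sum_t a t * b t) ^+ 2 <= (\sum_t a t ^+ 2) * \sum_t b t ^+ 2.
Proof.
have prodE : (\sum_t a t ^+ 2) * (\sum_t b t ^+ 2) =
    \sum_t \sum_u a t ^+ 2 * b u ^+ 2 by rewrite big_distrlr.
have prodE' : (\sum_t a t ^+ 2) * (\sum_t b t ^+ 2) =
    \sum_t \sum_u a u ^+ 2 * b t ^+ 2 by rewrite prodE exchange_big.
have sqrE : (\sum_t a t * b t) ^+ 2 = \sum_t \sum_u (a t * b t) * (a u * b u).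
  by rewrite expr2 big_distrlr.
have lagrange : (\sum_t a t ^+ 2) * (\sum_t b t ^+ 2) +
    (\sum_t a t ^+ 2) * (\sum_t b t ^+ 2) - 2 * (\sum_t a t * b t) ^+ 2 =
    \sum_t \sum_u (a t * b u - a u * b t) ^+ 2.
  rewrite {1}prodE prodE' sqrE mulr_sumr -big_split -sumrB.
  apply: eq_bigr => t _; rewrite mulr_sumr -big_split -sumrB.
  by apply: eq_bigr => u _ /=; ring.
have : 0 <= \sum_t \sum_u (a t * b u - a u * b t) ^+ 2.
  by do 2 (apply: sumr_ge0 => ? _); exact: sqr_ge0.
by rewrite -lagrange; lra.
Qed.

Section PseudoRandom.
Variables (R : realType) (F : finFieldType).
Implicit Types (i j : F * F) (f g : F * F -> R) (b : F -> R) (A : {set F}).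
Local Notation q := (#|F|%:R : R).

Let q_gt0 : 0 < q.
Proof. by rewrite ltr0n ltnW// card_finNzRing_gt1. Qed.

Definition incidence i j : F := i.1 * j.1 + i.2 + j.2.

Lemma incidenceC i j : incidence i j = incidence j i.
Proof. by rewrite /incidence mulrC addrAC. Qed.

Lemma incidence_uncorrelated b i i' : \sum_c b c = 0 -> i.1 != i'.1 ->
  \sum_j b (incidence i j) * b (incidence i' j) = 0.
Proof.
case: i i' => [i1 i2] [i1' i2'] /= b0 ii'; rewrite sum_pair.
pose shift (l c : F) := c - (i1 * l + i2).
have shift_inj (l : F) : injective (shift l) by move=> c d /addIr.
under eq_bigr => l _ do rewrite (reindex_inj (shift_inj l))/=.
rewrite exchange_big/= big1// => c _.
pose affine (l : F) := c + (i1' - i1) * l + (i2' - i2).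
have affine_inj : injective affine.
  by move=> x y /addIr/addrI/mulfI; apply; rewrite subr_eq0 eq_sym.
transitivity (b c * \sum_l b (affine l)).
  rewrite mulr_sumr; apply: eq_bigr => l _.
  by rewrite /incidence /shift /affine /=; congr (b _ * b _); ring.
by rewrite -(reindex_inj affine_inj (P := xpredT) (F := b)) b0 mulr0.
Qed.

Section Balanced.
Variable b : F -> R.
Hypotheses (b_sum0 : \sum_c b c = 0) (b_le1 : forall c, `|b c| <= 1).

Lemma incidence_correlation_le i i' :
  `|\sum_j b (incidence i j) * b (incidence i' j)| <= (i.1 == i'.1)%:R * q ^+ 2.
Proof.
have [_|ne] := eqVneq i.1 i'.1; last first.
  by rewrite incidence_uncorrelated// normr0 mul0r.
apply: (le_trans (ler_norm_sum _ _ _)).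
rewrite mul1r -card_sqr -[leRHS]mulr1 -sum_cst.
by apply: ler_sum => j _; rewrite normrM mulr_ile1.
Qed.

(* Only the [q ^ 3] pairs with equal first coordinates contribute. *)
Lemma incidence_energy_le f : unit_bounded f ->
  \sum_j (\sum_i b (incidence i j) * f i) ^+ 2 <= q ^+ 5.
Proof.
move=> f1; have -> : \sum_j (\sum_i b (incidence i j) * f i) ^+ 2 =
    \sum_i \sum_i' f i * f i' * \sum_j b (incidence i j) * b (incidence i' j).
  under [RHS]eq_bigr do under eq_bigr do rewrite mulr_sumr.
  under [RHS]eq_bigr do rewrite exchange_big; rewrite [RHS]exchange_big.
  apply: eq_bigr => j _; rewrite expr2 mulr_suml; apply: eq_bigr => i _.
  by rewrite mulr_sumr; apply: eq_bigr => i' _; ring.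
have fiber_card i : \sum_(i' : F * F) (i.1 == i'.1)%:R = q.
  rewrite sum_pair exchange_big -[RHS]mulr1 -sum_cst; apply: eq_bigr => d _.
  rewrite (bigD1 i.1)//= eqxx big1 ?addr0// => c.
  by rewrite eq_sym => /negPf ->.
have -> : q ^+ 5 = \sum_(i : F * F) \sum_(i' : F * F) (i.1 == i'.1)%:R * q ^+ 2.
  under eq_bigr do rewrite -mulr_suml fiber_card.
  by rewrite sum_cst card_sqr; ring.
apply: ler_sum => i _; apply: ler_sum => i' _.
apply: (le_trans (ler_norm _)); rewrite normrM.
apply: le_trans (incidence_correlation_le i i').
by rewrite ler_piMl// normrM mulr_ile1.
Qed.

Lemma incidence_discrepancy f g :
  unit_bounded f -> unit_bounded g ->
  `|\sum_i \sum_j b (incidence i j) * (f i * g j)| <= q ^+ 4 / Num.sqrt q.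
Proof.
move=> f1 g1; pose h j := \sum_i b (incidence i j) * f i.
have -> : \sum_i \sum_j b (incidence i j) * (f i * g j) = \sum_j g j * h j.
  rewrite exchange_big; apply: eq_bigr => j _.
  by rewrite mulr_sumr; apply: eq_bigr => i _; ring.
have q4_ge0 : 0 <= q ^+ 4 / Num.sqrt q.
  by rewrite divr_ge0 ?exprn_ge0 ?sqrtr_ge0.
rewrite -(@ler_pXn2r _ 2)// ?nnegrE// real_normK ?num_real//.
apply: (le_trans (sum_cauchy_schwarz _ _)).
rewrite exprMn exprVn sqr_sqrtr ?(ltW q_gt0)//.
have -> : (q ^+ 4) ^+ 2 / q = q ^+ 2 * q ^+ 5 by field; rewrite gt_eqF.
rewrite ler_pM ?incidence_energy_le ?sumr_ge0// => [j _|j _|].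
- exact: sqr_ge0.
- exact: sqr_ge0.
rewrite -card_sqr -[leRHS]mulr1 -sum_cst; apply: ler_sum => j _.
by rewrite -real_normK ?num_real// expr_le1.
Qed.

End Balanced.

Lemma incidence_set_discrepancy A f g :
  unit_bounded f -> unit_bounded g ->
  `|\sum_i \sum_j (incidence i j \in A)%:R * (f i * g j) -
    #|A|%:R / q * ((\sum_i f i) * \sum_j g j)| <= q ^+ 4 / Num.sqrt q.
Proof.
move=> f1 g1; pose density : R := #|A|%:R / q.
pose b c : R := (c \in A)%:R - density.
have b_sum0 : \sum_c b c = 0.
  by rewrite sumrB sum_indicator sum_cst mulrCA mulfV ?gt_eqF// mulr1 subrr.
have density01 : 0 <= density <= 1.
  by rewrite divr_ge0//= ler_pdivrMr// mul1r ler_nat max_card.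
have b_le1 c : `|b c| <= 1.
  by rewrite /b ler_norml; case: (c \in A) => /=; apply/andP; split; lra.
have := incidence_discrepancy b_sum0 b_le1 f1 g1.
rewrite (_ : \sum_i \sum_j b _ * _ =
    \sum_i \sum_j (incidence i j \in A)%:R * (f i * g j) -
    density * ((\sum_i f i) * \sum_j g j))//.
rewrite mulr_suml mulr_sumr -sumrB; apply: eq_bigr => i _.
by rewrite mulr_sumr mulr_sumr -sumrB; apply: eq_bigr => j _; rewrite /b; ring.
Qed.

End PseudoRandom.

Definition adj_weight (R : realType) (G : sgraph) (x y : G) : R := (adj x y)%:R.
Arguments adj_weight : clear implicits.

Section BlowUp.
Variables (R : realType) (P : wgraph R) (F : finFieldType).
Implicit Types (u v : P) (x y : P * (F * F)) (f : P * (F * F) -> R).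
Local Notation q := (#|F|%:R : R).

Let q_gt0 : 0 < q.
Proof. by rewrite ltr0n ltnW// card_finNzRing_gt1. Qed.

Definition level u v : nat := Num.truncn (q * weight u v).

Lemma level_itv u v : (level u v)%:R <= q * weight u v < (level u v)%:R + 1.
Proof. by rewrite natr1 truncn_itv// mulr_ge0 ?weight_ge0. Qed.

Lemma level_le_card u v : (level u v <= #|F|)%N.
Proof.
have /andP[level_le _] := level_itv u v.
by rewrite -(ler_nat R) (le_trans level_le)// ler_piMr ?weight_le1.
Qed.

Definition initial_segment n : {set F} := [set a | enum_rank a < n]%N.

Lemma card_initial_segment n : (n <= #|F|)%N -> #|initial_segment n| = n.
Proof.
move=> nF.
have -> : initial_segment n = enum_rank @^-1: [set i : 'I_#|F| | (i < n)%N].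
  by apply/setP => a; rewrite !inE.
rewrite on_card_preimset; last by apply: onW_bij; exact: enum_rank_bij.
by rewrite -sum1dep_card -(big_ord_widen _ (fun=> 1)%N nF) sum1_card card_ord.
Qed.

(* Between the fibres of [u] and [v] this is a pseudo-random bipartite graph of
   density about [weight u v]. *)
Definition blowup_adj x y : bool :=
  incidence x.2 y.2 \in initial_segment (level x.1 y.1).

Lemma blowup_adj_sym : symmetric blowup_adj.
Proof. by move=> x y; rewrite /blowup_adj incidenceC /level weightC. Qed.

Lemma blowup_adj_irrefl : irreflexive blowup_adj.
Proof.
by move=> x; rewrite /blowup_adj /level weight_diag mulr0 truncn0 inE ltn0.
Qed.

Definition blowup : sgraph := SGraph blowup_adj_sym blowup_adj_irrefl.

Lemma blowup_adj_weight_gt0 (x y : blowup) : adj x y -> 0 < weight x.1 y.1.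
Proof.
rewrite lt0r weight_ge0 andbT; apply: contraTneq => w0.
by rewrite /= /blowup_adj /level w0 mulr0 truncn0 inE ltn0.
Qed.

Lemma vector_coloring_blowup (c : R) (d : nat) (x : P -> 'rV[R]_d) :
  vector_coloring [rel u v | 0 < weight u v] c x ->
  vector_coloring (@adj blowup) c (fun y : blowup => x y.1).
Proof.
by move=> [x_unit x_adj]; split=> [y|y y' /blowup_adj_weight_gt0/x_adj].
Qed.

Definition fiber_mean f u : R := (\sum_i f (u, i)) / q ^+ 2.

Lemma norm_fiber_mean f u : unit_bounded f -> `|fiber_mean f u| <= 1.
Proof.
move=> f1; rewrite normrM normfV [`|q ^+ 2|]ger0_norm ?exprn_ge0//.
rewrite ler_pdivrMr ?exprn_gt0// mul1r (le_trans (ler_norm_sum _ _ _))//.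
by rewrite -card_sqr -[leRHS]mulr1 -sum_cst; apply: ler_sum.
Qed.

Lemma fiber_mean1 u : fiber_mean (fun=> 1) u = 1.
Proof.
by rewrite /fiber_mean sum_cst mulr1 card_sqr mulfV// expf_neq0// gt_eqF.
Qed.

Lemma blowup_fiber_form f u v : unit_bounded f ->
  `|\sum_i \sum_j (blowup_adj (u, i) (v, j))%:R * (f (u, i) * f (v, j)) -
    q ^+ 4 * (weight u v * (fiber_mean f u * fiber_mean f v))| <=
  q ^+ 4 * (2 / Num.sqrt q).
Proof.
move=> f1; set g := fiber_mean f; set n := level u v.
have q4_gt0 : 0 < q ^+ 4 by rewrite exprn_gt0.
have := incidence_set_discrepancy (initial_segment n)
  (fun i => f1 (u, i)) (fun j => f1 (v, j)).
rewrite card_initial_segment ?level_le_card//.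
have -> : n%:R / q * ((\sum_i f (u, i)) * \sum_j f (v, j)) =
    q ^+ 4 * (n%:R / q * (g u * g v)).
  by rewrite /g /fiber_mean; field; rewrite gt_eqF.
have rounding : `|n%:R / q - weight u v| <= (Num.sqrt q)^-1.
  have sqrt_ge1 : 1 <= Num.sqrt q.
    by rewrite -[leLHS]sqrtr1 ler_wsqrtr// ler1n ltnW// card_finNzRing_gt1.
  have q_inv : q^-1 <= (Num.sqrt q)^-1.
    rewrite lef_pV2 ?posrE ?sqrtr_gt0// -[leRHS](sqr_sqrtr (ltW q_gt0)) expr2.
    by rewrite ler_peMr// sqrtr_ge0.
  apply: le_trans q_inv; rewrite -(ler_pM2l q_gt0) mulfV ?gt_eqF//.
  rewrite -[q in q * `|_|]gtr0_norm// -normrM mulrBr mulrCA.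
  rewrite mulfV ?gt_eqF// mulr1 ler_norml.
  by have := level_itv u v; rewrite -/n => /andP[? ?]; apply/andP; split; lra.
have gg : `|g u * g v| <= 1 by rewrite normrM mulr_ile1 ?norm_fiber_mean.
have rounded :
    `|q ^+ 4 * ((n%:R / q - weight u v) * (g u * g v))| <= q ^+ 4 / Num.sqrt q.
  rewrite normrM (gtr0_norm q4_gt0) ler_pM2l// normrM -[leRHS]mulr1.
  by rewrite ler_pM.
rewrite -/n; set S := \sum_i _; move=> discrepancy.
have -> : S - q ^+ 4 * (weight u v * (g u * g v)) =
    S - q ^+ 4 * (n%:R / q * (g u * g v)) +
    q ^+ 4 * ((n%:R / q - weight u v) * (g u * g v)) by ring.
by apply: (le_trans (ler_normD _ _)); lra.
Qed.

Lemma quad_form_blowup f : unit_bounded f ->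
  `|quad_form (adj_weight R blowup) f -
    q ^+ 4 * quad_form (@weight R P) (fiber_mean f)| <=
  q ^+ 4 * (2 * #|P|%:R ^+ 2 / Num.sqrt q).
Proof.
move=> f1; have -> : quad_form (adj_weight R blowup) f =
    \sum_u \sum_v \sum_i \sum_j
      (blowup_adj (u, i) (v, j))%:R * (f (u, i) * f (v, j)).
  rewrite /quad_form sum_pair; apply: eq_bigr => u _.
  by rewrite [RHS]exchange_big/=; apply: eq_bigr => i _; rewrite sum_pair.
rewrite mulr_sumr -sumrB; under eq_bigr do rewrite mulr_sumr -sumrB.
have -> : q ^+ 4 * (2 * #|P|%:R ^+ 2 / Num.sqrt q) =
    \sum_(u : P) \sum_(v : P) q ^+ 4 * (2 / Num.sqrt q).
  by rewrite !sum_cst; ring.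
apply: (le_trans (ler_norm_sum _ _ _)); apply: ler_sum => u _.
apply: (le_trans (ler_norm_sum _ _ _)); apply: ler_sum => v _.
exact: blowup_fiber_form.
Qed.

Lemma total_blowup :
  `|total (adj_weight R blowup) - q ^+ 4 * total (@weight R P)| <=
  q ^+ 4 * (2 * #|P|%:R ^+ 2 / Num.sqrt q).
Proof.
have norm1 (x : P * (F * F)) : `|1| <= 1 :> R by rewrite normr1.
have := quad_form_blowup norm1; rewrite quad_form1.
suff -> : fiber_mean (fun=> 1) = fun=> 1 by rewrite quad_form1.
by apply/funext => u; exact: fiber_mean1.
Qed.

End BlowUp.

Lemma exists_finField_ge (R : archiRealDomainType) (a : R) :
  exists F : finFieldType, a <= #|F|%:R.
Proof.
have [n a_le_n] := exists_natS_ge a; have [p lt_np pr_p] := prime_above n.+1.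
exists 'F_p; rewrite card_Fp//; apply: (le_trans a_le_n).
by rewrite ler_nat ltnW.
Qed.

Lemma exists_quad_form_lb_blowup (R : realType) (P : wgraph R) (s s' K : R) :
  0 <= s < s' -> 0 < total (@weight R P) -> quad_form_lb s (@weight R P) ->
  exists F : finFieldType, K <= total (adj_weight R (blowup P F)) /\
    quad_form_lb s' (adj_weight R (blowup P F)).
Proof.
move=> /andP[s0 ss']; set t := total _ => t0 P_lb.
pose e := Num.min (t / 2) ((s' - s) * t / (1 + s')).
have e0 : 0 < e by rewrite lt_min !divr_gt0 ?mulr_gt0//; lra.
have e_half : e <= t / 2 by rewrite ge_min lexx.
have e_slack : e * (1 + s') <= (s' - s) * t.
  by rewrite -ler_pdivlMr ?ge_min ?lexx ?orbT//; lra.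
pose N : R := 2 * #|P|%:R ^+ 2.
have [F] := exists_finField_ge (Num.max ((N / e) ^+ 2) (2 * K / t)).
rewrite ge_max; set q := #|F|%:R => /andP[q_err q_K]; exists F.
have q1 : 1 <= q by rewrite ler1n ltnW// card_finNzRing_gt1.
have q4 : q <= q ^+ 4 by rewrite -[leLHS]expr1 ler_weXn2l.
have err_le : q ^+ 4 * (N / Num.sqrt q) <= q ^+ 4 * e.
  rewrite ler_pM2l; last lra.
  rewrite ler_pdivrMr ?sqrtr_gt0; last lra.
  rewrite mulrC -ler_pdivrMr// -[leLHS]ger0_norm; last first.
    by rewrite divr_ge0 ?mulr_ge0 ?exprn_ge0// ltW.
  by rewrite -sqrtr_sqr ler_wsqrtr.
have := total_blowup P F; rewrite -/q -/N -/t => /le_trans/(_ err_le).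
rewrite ler_norml => /andP[tot_ge _].
have q_half : q ^+ 4 * e <= q ^+ 4 * (t / 2) by rewrite ler_pM2l//; lra.
split.
  move: q_K; rewrite ler_pdivrMr// => q_K.
  have : q * t <= q ^+ 4 * t by rewrite ler_pM2r.
  lra.
move=> f f1; have := quad_form_blowup f1.
rewrite -/q -/N => /le_trans/(_ err_le); rewrite ler_norml => /andP[form_ge _].
have := P_lb _ (fun u => norm_fiber_mean u f1); rewrite -/t => P_form.
have q4_ge0 : 0 <= q ^+ 4 by lra.
have := ler_wpM2l q4_ge0 P_form; have := ler_wpM2l q4_ge0 e_slack.
have s'0 : 0 <= s' by lra.
have := ler_wpM2l s'0 tot_ge; lra.
Qed.

(** * Cuts and edges *)

Section Cuts.
Variables (R : realType) (G : sgraph).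
Implicit Types (C : {set G}) (xy : G * G).

Definition endpoints xy : {set G} := [set xy.1; xy.2]%SET.

Lemma eq_endpoints (a b x y : G) : ([set x; y]%SET == [set a; b]%SET) =
  ((x, y) == (a, b)) || ((x, y) == (b, a)).
Proof.
apply/eqP/idP => [xy_ab|/orP[/eqP[-> ->]//|/eqP[-> ->]]]; last first.
  exact: finset.setUC.
have xE : x \in [set a; b]%SET by rewrite -xy_ab set21.
have yE : y \in [set a; b]%SET by rewrite -xy_ab set22.
have aE : a \in [set x; y]%SET by rewrite xy_ab set21.
have bE : b \in [set x; y]%SET by rewrite xy_ab set22.
move: xE yE aE bE; rewrite !inE => /orP[]/eqP-> /orP[]/eqP->;
  rewrite ?eqxx ?orbT ?orbb //.
  by move=> _ /eqP->; rewrite eqxx.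
by move=> /eqP-> _; rewrite eqxx.
Qed.

Lemma total_adj_weight : total (adj_weight R G) = 2 * #|edges G|%:R.
Proof.
rewrite /total /adj_weight -(card_set_pair R (@adj G)) -natrM -sum1_card.
rewrite (partition_big endpoints (mem (edges G)))/=.
  rewrite mulnC -sum_nat_const; congr (_%:R).
  apply: eq_bigr => E /imset2P[a b _].
  rewrite !inE => ab ->; rewrite sum1dep_card.
  rewrite (_ : [set _ | _] = [set (a, b); (b, a)]%SET) ?cards2.
    by rewrite xpair_eqE negb_and; case: eqVneq ab => // ->; rewrite adj_irrefl.
  apply/setP => -[x y]; rewrite !inE /endpoints eq_endpoints /=.
  by apply: andb_idl => /orP[]/eqP[-> ->]//; rewrite adj_sym.
move=> [x y]; rewrite inE => xy.
by apply/imset2P; exists x y; rewrite ?inE.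
Qed.

Definition cut_sign C (x : G) : R := (-1) ^+ (x \in C).

Lemma card_cut_edges C : #|cut_edges C|%:R =
  (total (adj_weight R G) - quad_form (adj_weight R G) (cut_sign C)) / 4.
Proof.
pose crossing x y := [&& x \in C, y \notin C & adj x y].
have -> : cut_edges C = endpoints @: [set xy | crossing xy.1 xy.2].
  apply/setP => E; apply/imset2P/imsetP => [[x y xC]|[[x y]]].
    rewrite !inE => /andP[yC xy] ->; exists (x, y) => //.
    by rewrite inE /crossing xC yC.
  by rewrite inE /crossing /= => /and3P[xC yC xy] ->; exists x y;
    rewrite ?inE ?yC.
rewrite card_in_imset => [|[x y] [a b]]; last first.
  rewrite !inE /crossing /= => /and3P[xC yC _] /and3P[aC bC _] /eqP.
  rewrite eq_endpoints => /orP[]/eqP// [xb _].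
  by move: bC; rewrite -xb xC.
rewrite card_set_pair; have swap : \sum_x \sum_y (adj x y)%:R * cut_sign C x =
    \sum_x \sum_y (adj x y)%:R * cut_sign C y.
  rewrite exchange_big; apply: eq_bigr => x _; apply: eq_bigr => y _.
  by rewrite adj_sym.
transitivity ((total (adj_weight R G) -
    \sum_x \sum_y (adj x y)%:R * cut_sign C x +
    \sum_x \sum_y (adj x y)%:R * cut_sign C y
    - quad_form (adj_weight R G) (cut_sign C)) / 4); last by rewrite swap subrK.
rewrite -sumrB -big_split -sumrB mulr_suml; apply: eq_bigr => x _.
rewrite -sumrB -big_split -sumrB mulr_suml; apply: eq_bigr => y _.
rewrite /crossing /adj_weight /cut_sign /=.
case: (x \in C); case: (y \in C); case: (adj x y) => /=;
  by rewrite ?expr0 ?expr1; field.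
Qed.

Lemma surplus_cut :
  exists C, surplus R G = - quad_form (adj_weight R G) (cut_sign C) / 4.
Proof.
have [|C maxE] := bigop.eq_bigmax (fun C : {set G} => #|cut_edges C|).
  by apply/card_gt0P; exists finset.set0.
exists C; rewrite /surplus /maxcut maxE card_cut_edges total_adj_weight; lra.
Qed.

Lemma surplus_le (s : R) : quad_form_lb s (adj_weight R G) ->
  surplus R G <= s / 2 * #|edges G|%:R.
Proof.
have [C ->] := surplus_cut => /(_ (cut_sign C)) form_ge.
have cut_sign_le1 x : `|cut_sign C x| <= 1 by rewrite /cut_sign normr_sign.
by have := form_ge cut_sign_le1; rewrite total_adj_weight; lra.
Qed.

End Cuts.

(** * Disjoint unions with complete graphs *)

Section DisjointUnion.
Variables G H : sgraph.

Definition union_adj (x y : G + H) : bool :=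
  match x, y with
  | inl a, inl b => adj a b
  | inr a, inr b => adj a b
  | _, _ => false
  end.

Lemma union_adj_sym : symmetric union_adj.
Proof. by move=> [a|a] [b|b] //=; exact: adj_sym. Qed.

Lemma union_adj_irrefl : irreflexive union_adj.
Proof. by move=> [a|a] /=; exact: adj_irrefl. Qed.

Definition disjoint_union : sgraph := SGraph union_adj_sym union_adj_irrefl.

Variable R : realType.

Lemma quad_form_union (f : disjoint_union -> R) :
  quad_form (adj_weight R disjoint_union) f =
  quad_form (adj_weight R G) (f \o inl) + quad_form (adj_weight R H) (f \o inr).
Proof.
rewrite /quad_form big_sumType; congr (_ + _); apply: eq_bigr => x _;
  rewrite big_sumType/=.
  by rewrite [X in _ + X]big1 ?addr0// => y _; rewrite mul0r.
by rewrite [X in X + _]big1 ?add0r// => y _; rewrite mul0r.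
Qed.

Lemma total_union : total (adj_weight R disjoint_union) =
  total (adj_weight R G) + total (adj_weight R H).
Proof. by rewrite -!quad_form1 quad_form_union. Qed.

Lemma quad_form_lb_union (s s' : R) : 0 <= s' ->
  total (adj_weight R H) <= (s' - s) * total (adj_weight R G) ->
  quad_form_lb s (adj_weight R G) ->
  quad_form_lb s' (adj_weight R disjoint_union).
Proof.
move=> s'0 H_small G_lb f f1; rewrite quad_form_union total_union.
have := G_lb (f \o inl) (fun x => f1 (inl x)).
have := norm_quad_form (fun x y => ler0n R (adj x y)) (fun x => f1 (inr x)).
rewrite ler_norml => /andP[H_ge _].
have : 0 <= s' * total (adj_weight R H).
  by rewrite mulr_ge0//; do 2 (apply: sumr_ge0 => ? _).
lra.
Qed.

Lemma vector_coloring_union (c : R) (d d' : nat)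
    (x : G -> 'rV[R]_d) (y : H -> 'rV[R]_d') :
  vector_coloring (@adj G) c x -> vector_coloring (@adj H) c y ->
  vector_coloring (@adj disjoint_union) c
    (fun v => match v with
              | inl a => row_mx (x a) 0
              | inr b => row_mx 0 (y b)
              end).
Proof.
move=> [x_unit x_adj] [y_unit y_adj].
by split=> [[a|b]|[a|b] [a'|b'] //= ab];
  rewrite dotp_row_mx !dotp0l ?addr0 ?add0r//; [exact: x_adj|exact: y_adj].
Qed.

End DisjointUnion.

Section CompleteGraph.
Variables (R : realType) (n : nat).

Lemma complete_adj_sym : symmetric [rel i j : 'I_n.+2 | i != j].
Proof. by move=> i j /=; rewrite eq_sym. Qed.

Lemma complete_adj_irrefl : irreflexive [rel i j : 'I_n.+2 | i != j].
Proof. by move=> i /=; rewrite eqxx. Qed.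

Definition complete_graph : sgraph :=
  SGraph complete_adj_sym complete_adj_irrefl.

Definition simplex (i : 'I_n.+2) : 'rV[R]_n.+2 :=
  Num.sqrt (n.+2%:R / n.+1%:R) *: (delta_mx 0 i - const_mx n.+2%:R^-1).

Lemma dotp_simplex (i j : 'I_n.+2) :
  dotp (simplex i) (simplex j) = if i == j then 1 else - n.+1%:R^-1.
Proof.
have nS : n.+2%:R = n.+1%:R + 1 :> R by rewrite -natr1.
have n1 : n.+1%:R != 0 :> R by rewrite pnatr_eq0.
have n2 : n.+1%:R + 1 != 0 :> R by rewrite -nS pnatr_eq0.
have sum_delta (l : 'I_n.+2) : \sum_k (k == l)%:R = 1 :> R.
  by rewrite (bigD1 l)//= eqxx big1 ?addr0// => k /negPf ->.
have sum_deltaM : \sum_(k < n.+2) (k == i)%:R * (k == j)%:R = (i == j)%:R :> R.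
  rewrite (bigD1 i)//= eqxx mul1r big1 ?addr0// => k /negPf ->.
  by rewrite mul0r.
pose vertex l : 'rV[R]_n.+2 := delta_mx 0 l - const_mx n.+2%:R^-1.
have dotp_vertex : dotp (vertex i) (vertex j) = (i == j)%:R - n.+2%:R^-1.
  transitivity (\sum_(k < n.+2) (k == i)%:R * (k == j)%:R
      - n.+2%:R^-1 * \sum_(k < n.+2) (k == i)%:R
      - n.+2%:R^-1 * \sum_(k < n.+2) (k == j)%:R
      + \sum_(k < n.+2) n.+2%:R^-1 ^+ 2 : R).
    rewrite !mulr_sumr -!sumrB -big_split; apply: eq_bigr => k _.
    by rewrite !mxE !eqxx /=; ring.
  by rewrite sum_deltaM !sum_delta sum_cst card_ord nS; field.
rewrite dotpZl dotpZr mulrA -expr2 sqr_sqrtr ?divr_ge0// dotp_vertex.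
rewrite nS; move: (n.+1%:R : R) n1 n2 => a a_neq0 a1_neq0.
by case: (i == j) => /=; field; rewrite a_neq0 a1_neq0.
Qed.

Lemma vector_coloring_simplex :
  vector_coloring (@adj complete_graph) n.+1%:R^-1 simplex.
Proof.
split=> [i|i j /= /negPf ij]; first by rewrite dotp_simplex eqxx.
by rewrite dotp_simplex ij.
Qed.

(* The vectors of a clique sum to a vector of nonnegative squared length. *)
Lemma vector_coloring_complete_le (c : R) (d : nat)
    (x : complete_graph -> 'rV[R]_d) :
  vector_coloring (@adj complete_graph) c x -> n.+1%:R * c <= 1.
Proof.
move=> [x_unit x_adj]; have := dotp_ge0 (\sum_i x i); rewrite dotp_sum.
have row_le i : \sum_j dotp (x i) (x j) <= 1 - n.+1%:R * c.
  rewrite (bigD1 i)//= x_unit lerD2l.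
  apply: (@le_trans _ _ (\sum_(j | j != i) - c)).
    by apply: ler_sum => j ji; apply: x_adj; rewrite /= eq_sym.
  by rewrite sumr_const cardC1 card_ord mulNrn mulr_natl.
move=> /le_trans/(_ (ler_sum _ (fun i _ => row_le i))).
by rewrite sum_cst card_ord pmulr_rge0 ?ltr0n// subr_ge0.
Qed.

End CompleteGraph.

Lemma vector_chromatic_number_union_complete (R : realType) (G : sgraph)
    (n d : nat) (x : G -> 'rV[R]_d) :
  vector_coloring (@adj G) n.+1%:R^-1 x ->
  is_vector_chromatic_number (disjoint_union G (complete_graph n))
    (n.+2%:R : R).
Proof.
move=> x_col; have nE : n.+2%:R - 1 = n.+1%:R :> R by rewrite -natr1 addrK.
split; first by rewrite ler_nat.
  have := vector_coloring_union x_col (vector_coloring_simplex R n).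
  by move=> [y_unit y_adj]; do 2 eexists; split;
    [exact: y_unit|rewrite nE; exact: y_adj].
move=> kappa kappa2 [d' [y [y_unit y_adj]]].
have clique :
    vector_coloring (@adj (complete_graph n)) (kappa - 1)^-1 (y \o inr).
  by split=> [i|i j ij]; [exact: y_unit|exact: (y_adj (inr i) (inr j))].
have := vector_coloring_complete_le clique.
by rewrite ler_pdivrMr; lra.
Qed.

Lemma exists_small_surplus_graph (R : realType) (n : nat) (r s : R) :
  n.+1%:R^-1 < r <= 1 -> r * (2 / pi) + r ^+ 3 < s ->
  exists G : sgraph, [/\ (0 < #|edges G|)%N,
    is_vector_chromatic_number G (n.+2%:R : R) &
    surplus R G <= s / 2 * #|edges G|%:R].
Proof.
move=> /andP[nr r1]; set b := _ + _ => bs.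
have n_inv : 0 < n.+1%:R^-1 :> R by rewrite invr_gt0 ltr0n.
have c0r : 0 < (n.+1%:R^-1 : R) < r by rewrite n_inv.
have b0 : 0 < b.
  have r0 : 0 < r by case/andP: c0r => /lt_trans/[apply].
  by rewrite addr_gt0 ?exprn_gt0// mulr_gt0// divr_gt0 ?pi_gt0.
pose s1 := (2 * b + s) / 3; pose s2 := (b + 2 * s) / 3.
have bs1 : b < s1 by rewrite /s1; lra.
have s12 : 0 <= s1 < s2 by rewrite /s1 /s2; lra.
have s2s : s2 < s by rewrite /s2; lra.
have [P [d [x [x_col P0 P_lb]]]] := exists_quad_form_lb_wgraph c0r r1 bs1.
pose K := total (adj_weight R (complete_graph n)).
have K0 : 0 <= K by do 2 (apply: sumr_ge0 => ? _).
have [F [G_ge G_lb]] :=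
  exists_quad_form_lb_blowup ((1 + K) / (s - s2)) s12 P0 P_lb.
exists (disjoint_union (blowup P F) (complete_graph n)); split.
- have G_gt0 : 0 < total (adj_weight R (blowup P F)).
    by apply: lt_le_trans G_ge; rewrite divr_gt0; lra.
  have := total_adj_weight R (disjoint_union (blowup P F) (complete_graph n)).
  by rewrite total_union -(ltr0n R) -/K; lra.
- apply: vector_chromatic_number_union_complete.
  exact: (vector_coloring_blowup F x_col).
- apply/surplus_le/(quad_form_lb_union _ _ G_lb); first lra.
  by move: G_ge; rewrite ler_pdivrMr -/K; lra.
Qed.

Lemma exists_clique_size_correlation (R : realType) (delta : R) :
  0 < delta < 1 ->
  exists (n : nat) (r : R), n.+1%:R^-1 < r <= 1 /\
    r * (2 / pi) + r ^+ 3 < 2 / ((pi - delta) * n.+1%:R).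
Proof.
case/andP=> d0 d1; have pi2 := pi_ge2 R.
pose gap : R := 2 / (pi - delta) - 2 / pi.
have gap0 : 0 < gap by rewrite subr_gt0 ltr_pM2l// ltf_pV2 ?posrE; lra.
have pi_inv : 2 / pi <= 1 :> R by rewrite ler_pdivrMr; lra.
have [n] := exists_natS_ge (Num.max 2 (10 / gap)).
rewrite ge_max => /andP[n2 n_gap].
pose e : R := n.+1%:R^-1; have e0 : 0 < e by rewrite invr_gt0 ltr0n.
have e2 : 2 * e <= 1 by rewrite ler_pdivrMr ?mul1r// ltr0n.
have e_gap : 10 * e <= gap by rewrite ler_pdivrMr ?ltr0n// mulrC -ler_pdivrMr.
exists n, (e * (1 + e)); rewrite invfM -/e; split.
  by apply/andP; split; [rewrite ltr_pMr//; lra|nra].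
have cubic : (e * (1 + e)) ^+ 3 <= e * (8 * e).
  have r_le : e * (1 + e) <= 2 * e by rewrite mulrC ler_pM2r//; lra.
  have r_ge0 : 0 <= e * (1 + e) by rewrite mulr_ge0//; lra.
  apply: (le_trans (lerXn2r 3 r_ge0 (le_trans r_ge0 r_le) r_le)).
  rewrite (_ : (2 * e) ^+ 3 = e * (8 * e * e)); last by ring.
  by rewrite ler_pM2l// ler_piMr//; lra.
have linear : e * (1 + e) * (2 / pi) <= e * (2 / pi + e).
  by rewrite -mulrA ler_pM2l// mulrDl mul1r lerD2l ler_piMr ?(ltW e0).
have : e * (10 * e) <= e * gap by rewrite ler_pM2l.
have pi_delta : 2 / (pi - delta) = 2 / pi + gap by rewrite /gap; ring.
rewrite [ltRHS]mulrA pi_delta.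
by have := mulr_gt0 e0 e0; lra.
Qed.

Theorem theorem2 (R : realType) (delta : R) (hdelta : 0 < delta < 1) :
  exists (G : sgraph) (chi_vec : R),
    [/\ (0 < #|edges G|)%N,
        is_vector_chromatic_number G chi_vec &
        surplus R G <= #|edges G|%:R / ((pi - delta) * (chi_vec - 1))].
Proof.
have [n [r [nr gap]]] := exists_clique_size_correlation hdelta.
have [G [G_edges G_chi G_surplus]] := exists_small_surplus_graph nr gap.
exists G, n.+2%:R; split=> //.
have -> : n.+2%:R - 1 = n.+1%:R :> R by rewrite -natr1 addrK.
by rewrite mulrC -[_^-1](mulfK (_ : 2 != 0)) ?pnatr_eq0// [_^-1 * 2]mulrC.
Qed.
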